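(* Let $\alpha=u\in\mathbb{R}$, $b_1,b_2\in\mathbb{C}$, $b\geq0$, and $$A=\begin{bmatrix}\alpha&0&\overline{b_1}+1&0\\0&\alpha&b&\overline{b_2}+1\\ b_1-1&b&-\alpha&0\\0&b_2-1&0&-\alpha\end{bmatrix}.$$ Write $\xi_j=\operatorname{Re}b_j$, $\eta_j=\operatorname{Im}b_j$ for $j=1,2$. Then the numerical range $W(A)$ is bi-elliptical if and only if $b\neq0$ and either (i) $\eta_1=\eta_2$ and $4b^2u^2=(\xi_1^2-\xi_2^2)^2$, or (ii) $u=\xi_1=\xi_2=0$.
   Context: The numerical range of $A\in\mathbb{C}^{n\times n}$ is $W(A)=\{\langle Ax,x\rangle: x\in\mathbb{C}^n,\ \|x\|=1\}$. $W(A)$ is called bi-elliptical if it is the convex hull of two (non-degenerate) ellipses with distinct centers, neither of which is contained in the convex hull of the other (so that $W(A)$ is not simply an elliptical disk). Circles count as ellipses. *)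

(* Defs.v *)
From HB Require Import structures.
From mathcomp Require Import all_boot all_order all_algebra.
From mathcomp Require Import spectral complex.
From mathcomp Require Import classical_sets reals convex.

Set Implicit Arguments.
Unset Strict Implicit.
Unset Printing Implicit Defensive.

Import Order.TTheory GRing.Theory Num.Theory.

Local Open Scope classical_set_scope.
Local Open Scope ring_scope.
Local Open Scope complex_scope.

Definition mx_of_rows (V : nmodType) (m n : nat) (rows : seq (seq V)) :
    'M[V]_(m, n) :=
  \matrix_(i < m, j < n) nth 0 (nth [::] rows i) j.

(* Column vectors are transposed because [dotmx] is defined on row vectors;
   it is linear in its first argument and conjugate-linear in the second. *)
Definition inner (C : numClosedFieldType) (n : nat) (x y : 'cV[C]_n) : C :=
  dotmx x^T y^T.

Definition vnorm (C : numClosedFieldType) (n : nat) (x : 'cV[C]_n) : C :=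
  sqrtC (inner x x).

Definition numerical_range (C : numClosedFieldType) (n : nat) (A : 'M[C]_n) :
    set C :=
  [set z | exists2 x : 'cV[C]_n, vnorm x = 1 & z = inner (A *m x) x].

(* [Rcomplex R] is R[i] seen as a vector space over R. *)
Definition convex_hull (R : realType) (S : set R[i]) : set R[i] :=
  smallest (@convex_set R (Rcomplex R)) S.

(* The ellipse (a curve, not a disk) with center [c] and half-axes [p], [q], in
   the directions of the unit vectors [w] and [i w]: multiplying [z - c] by the
   conjugate of [w] gives its coordinates along these axes. *)
Definition ellipse (R : realType) (c w : R[i]) (p q : R) : set R[i] :=
  [set z | (complex.Re ((w^*)%R * (z - c)) / p) ^+ 2
           + (complex.Im ((w^*)%R * (z - c)) / q) ^+ 2 = 1].

Definition is_ellipse (R : realType) (c : R[i]) (E : set R[i]) : Prop :=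
  exists (w : R[i]) (p q : R),
    [/\ `|w| = 1, 0 < p, 0 < q & E = ellipse c w p q].

Definition bi_elliptical (R : realType) (W : set R[i]) : Prop :=
  exists (c1 c2 : R[i]) (E1 E2 : set R[i]),
    [/\ is_ellipse c1 E1 /\ is_ellipse c2 E2,
        c1 <> c2,
        ~ (E1 `<=` convex_hull E2),
        ~ (E2 `<=` convex_hull E1)
      & W = convex_hull (E1 `|` E2)].

(* Main.v *)
(* The support function of W(A) at (c, s) is the largest eigenvalue of
   c Re A + s Im A, which is the block matrix [c u, M^*; M, - c u] with
   M = c B + i s, B = [b1, b; 0, b2].  Its square is c^2 u^2 plus the largest
   eigenvalue of the 2 x 2 matrix M^* M, hence of the form T + |c| sqrt(q) / 2
   for two quadratic forms T and q in (c, s).  The support function of an ellipse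
   is l + sqrt(Q) with l linear and Q a positive definite quadratic form.
   If W(A) is bi-elliptical, one of the ellipses is not centered at 0, and its
   support function agrees with that of W(A) on an open set of directions;
   squaring twice and using that Q is not a square gives l^2 + Q = T and
   16 l^2 Q = c^2 q, and comparing coefficients gives (i) or (ii).  Conversely,
   under (i) or (ii), q = 16 x0^2 Q and T = x0^2 c^2 + Q for some x0 > 0, hence
   the support function is x0 |c| + sqrt(Q), that of the hull of two translates of
   one ellipse.  As W(A) is convex (Toeplitz-Hausdorff), it remains to see that
   it contains the outer half of each translate.  Its points are the unique
   maximizers in their normal directions, where the support function is attained,
   except for the top and bottom points, for which we need explicit vectors. *)

Require Import Defs.
From HB Require Import structures.
From mathcomp Require Import all_boot all_order all_algebra.
From mathcomp Require Import spectral complex.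
From mathcomp Require Import boolp classical_sets interval_inference.
From mathcomp Require Import reals convex.
From mathcomp Require Import ring lra.

Set Implicit Arguments.
Unset Strict Implicit.
Unset Printing Implicit Defensive.

Import Order.TTheory GRing.Theory Num.Theory.

Local Open Scope complex_scope.
Local Open Scope ring_scope.
Local Notation Re := complex.Re.
Local Notation Im := complex.Im.

(** * Convex hulls and ellipses *)

Lemma convex_setE (R : realType) (S : set R[i]) :
  @convex_set R (Rcomplex R) S <->
  (forall x y (t : R), 0 <= t -> t <= 1 -> S x -> S y ->
     S ((t * Re x + (1 - t) * Re y) +i* (t * Im x + (1 - t) * Im y))).
Proof.
split=> [cS x y t t0 t1 Sx Sy|cS].
  have tP : Itv.spec (@Itv.num_sem R) (Itv.Real `[0%Z, 1%Z]) t.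
    by rewrite /Itv.num_sem /= num_real in_itv /= t0 t1.
  have := cS x y (Itv.mk tP); rewrite !inE => /(_ Sx Sy).
  by case: x y {Sx Sy} => [x1 x2] [y1 y2]; rewrite /conv /=.
move=> x y l; rewrite !inE => Sx Sy.
have l0 : 0 <= l%:num by []. have l1 : l%:num <= 1 by [].
have := cS x y l%:num l0 l1 Sx Sy.
by case: x y {Sx Sy} => [x1 x2] [y1 y2].
Qed.

(** Horizontal segments suffice to fill disks and hulls, which is done row by row. *)
Lemma convex_set_hsegment (R : realType) (S : set R[i]) (x1 x2 x y : R) :
  @convex_set R (Rcomplex R) S -> S (x1 +i* y) -> S (x2 +i* y) ->
  x1 <= x -> x <= x2 -> S (x +i* y).
Proof.
move=> /convex_setE cS S1 S2 h1 h2.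
have [e|ne] := eqVneq x1 x2.
  by have -> : x = x1 by apply/eqP; rewrite eq_le h1 e h2.
have d0 : 0 < x2 - x1 by rewrite subr_gt0 lt_neqAle ne (le_trans h1 h2).
have t0 : 0 <= (x - x1) / (x2 - x1) by rewrite divr_ge0 ?subr_ge0 // ltW // -subr_gt0.
have t1 : (x - x1) / (x2 - x1) <= 1 by rewrite ler_pdivrMr // mul1r lerD2r.
have := cS (x2 +i* y) (x1 +i* y) _ t0 t1 S2 S1 => /=.
have -> : (x - x1) / (x2 - x1) * x2 + (1 - (x - x1) / (x2 - x1)) * x1 = x.
  by field; rewrite gt_eqF.
by rewrite -mulrDl addrC subrK mul1r.
Qed.

Lemma convex_hull_convex (R : realType) (S : set R[i]) :
  @convex_set R (Rcomplex R) (convex_hull S).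
Proof.
apply/convex_setE => x y t t0 t1 Sx Sy M [cM SM].
by move/convex_setE: (cM); apply => //; [apply: Sx|apply: Sy].
Qed.

Lemma sub_convex_hull (R : realType) (S : set R[i]) z : S z -> convex_hull S z.
Proof. by move=> Sz M [_]; apply. Qed.

Lemma convex_hull_min (R : realType) (S M : set R[i]) :
  @convex_set R (Rcomplex R) M -> (forall z, S z -> M z) ->
  forall z, convex_hull S z -> M z.
Proof. by move=> cM SM z; apply; split. Qed.

Lemma convex_hull_halfplane (R : realType) (S : set R[i]) (c s h : R) :
  (forall z, S z -> c * Re z + s * Im z <= h) ->
  forall z, convex_hull S z -> c * Re z + s * Im z <= h.
Proof.
move=> Sh; apply: (@convex_hull_min R S [set z | c * Re z + s * Im z <= h]) => //.
apply/convex_setE => x y t t0 t1 /= hx hy.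
have := ler_wpM2l t0 hx; have : 0 <= 1 - t by rewrite subr_ge0.
move/ler_wpM2l => /(_ _ _ hy); nra.
Qed.


(** * Ellipses described by their dual quadratic forms *)

Definition dual_form (R : realType) (k m l c s : R) : R :=
  k * c ^+ 2 + 2 * m * c * s + l * s ^+ 2.

(* The ellipse whose support function is [c, s |-> c * Re o + s * Im o +
   Num.sqrt (dual_form k m l c s)]. *)
Definition dual_ellipse (R : realType) (o : R[i]) (k m l : R) : set R[i] :=
  [set z | l * (Re z - Re o) ^+ 2 - 2 * m * (Re z - Re o) * (Im z - Im o)
           + k * (Im z - Im o) ^+ 2 = k * l - m ^+ 2].

Lemma normc_eq1 (R : realType) (w : R[i]) :
  `|w| = 1 <-> Re w ^+ 2 + Im w ^+ 2 = 1.
Proof.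
rewrite normc_def; split=> [[]|->]; last by rewrite sqrtr1.
move=> e; rewrite -[LHS]sqr_sqrtr ?e ?expr1n //.
by rewrite addr_ge0 ?sqr_ge0.
Qed.

(** The form with coefficients [k], [m], [l] is the diagonal form of [p ^+ 2] and [q ^+ 2] rotated
    by [w]. Its determinant is [(p * q) ^+ 2], and clearing this denominator in the equation of the
    ellipse leaves the adjugate form. *)
Lemma ellipse_dual (R : realType) (o w : R[i]) (p q : R) :
  `|w| = 1 -> 0 < p -> 0 < q ->
  ellipse o w p q =
  dual_ellipse o (p ^+ 2 * Re w ^+ 2 + q ^+ 2 * Im w ^+ 2)
    ((p ^+ 2 - q ^+ 2) * (Re w * Im w))
    (p ^+ 2 * Im w ^+ 2 + q ^+ 2 * Re w ^+ 2).
Proof.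
move=> /normc_eq1 w1 p0 q0; apply/seteqP; rewrite /ellipse /dual_ellipse.
case: o w w1 => [o1 o2] [w1 w2] /= w12.
have pq0 : (p * q) ^+ 2 != 0 by rewrite expf_neq0 ?mulf_neq0 ?gt_eqF.
have polar X Y :
  ((w1 * X - - w2 * Y) / p) ^+ 2 + ((w1 * Y + - w2 * X) / q) ^+ 2 = 1 <->
  (p ^+ 2 * w2 ^+ 2 + q ^+ 2 * w1 ^+ 2) * X ^+ 2
  - 2 * ((p ^+ 2 - q ^+ 2) * (w1 * w2)) * X * Y
  + (p ^+ 2 * w1 ^+ 2 + q ^+ 2 * w2 ^+ 2) * Y ^+ 2 =
  (p ^+ 2 * w1 ^+ 2 + q ^+ 2 * w2 ^+ 2) * (p ^+ 2 * w2 ^+ 2 + q ^+ 2 * w1 ^+ 2)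
  - ((p ^+ 2 - q ^+ 2) * (w1 * w2)) ^+ 2.
  have -> : (p ^+ 2 * w1 ^+ 2 + q ^+ 2 * w2 ^+ 2)
      * (p ^+ 2 * w2 ^+ 2 + q ^+ 2 * w1 ^+ 2)
      - ((p ^+ 2 - q ^+ 2) * (w1 * w2)) ^+ 2 = (p * q) ^+ 2.
    by rewrite -[RHS]mulr1 -[1](expr1n _ 2) -w12; ring.
  have -> : ((w1 * X - - w2 * Y) / p) ^+ 2 + ((w1 * Y + - w2 * X) / q) ^+ 2 =
      ((p ^+ 2 * w2 ^+ 2 + q ^+ 2 * w1 ^+ 2) * X ^+ 2
       - 2 * ((p ^+ 2 - q ^+ 2) * (w1 * w2)) * X * Y
       + (p ^+ 2 * w1 ^+ 2 + q ^+ 2 * w2 ^+ 2) * Y ^+ 2) / (p * q) ^+ 2.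
    by field; rewrite !gt_eqF.
  split=> [/(canRL (divfK pq0))|->]; first by rewrite mul1r.
  by rewrite divff.
by split=> -[x y] /= /polar.
Qed.

(** The equation expresses that the off-diagonal entry of the symmetric matrix with entries [k],
    [m], [l] vanishes in the orthonormal basis [w], [i w]. *)
Lemma symmetric_diagonalization (R : realType) (k m l : R) :
  exists2 w : R[i], `|w| = 1 &
    m * (Re w ^+ 2 - Im w ^+ 2) = (k - l) * (Re w * Im w).
Proof.
have [->|m0] := eqVneq m 0.
  by exists 1; rewrite ?normr1 //= !mul0r mulr0 mulr0.
pose r := Num.sqrt ((k - l) ^+ 2 + 4 * m ^+ 2).
have r2 : r ^+ 2 = (k - l) ^+ 2 + 4 * m ^+ 2.
  by rewrite sqr_sqrtr // addr_ge0 ?sqr_ge0 // mulr_ge0 ?sqr_ge0.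
(* [(v1, v2)] is an eigenvector for the eigenvalue [(k + l + r) / 2], nonzero because [m] is. *)
pose v1 := 2 * m; pose v2 := r - (k - l).
have v0 : 0 < v1 ^+ 2 + v2 ^+ 2.
  by rewrite ltr_pwDl ?sqr_ge0 // exprn_even_gt0 //= mulf_neq0 ?pnatr_eq0.
pose n := Num.sqrt (v1 ^+ 2 + v2 ^+ 2).
have n0 : n != 0 by rewrite gt_eqF ?sqrtr_gt0.
have n2 : n ^+ 2 = v1 ^+ 2 + v2 ^+ 2 by rewrite sqr_sqrtr ?ltW.
exists ((v1 / n) +i* (v2 / n)).
  by apply/normc_eq1 => /=; rewrite !expr_div_n -mulrDl -n2 divff ?expf_neq0.
rewrite /= !expr_div_n -mulrBl mulrACA -invfM -expr2 !mulrA.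
congr (_ / _); rewrite /v1 /v2.
apply/eqP; rewrite -subr_eq0; apply/eqP.
transitivity (m * ((k - l) ^+ 2 + 4 * m ^+ 2 - r ^+ 2)); first by ring.
by rewrite r2 subrr mulr0.
Qed.

Lemma is_ellipseP (R : realType) (o : R[i]) (E : set R[i]) :
  is_ellipse o E <->
  exists k m l, [/\ 0 < k, 0 < l, m ^+ 2 < k * l & E = dual_ellipse o k m l].
Proof.
split=> [[w [p [q [w1 p0 q0 ->]]]]|[k [m [l [k0 l0 kml ->]]]]].
  move/normc_eq1: (w1) => w12.
  have [p2 q2] : 0 < p ^+ 2 /\ 0 < q ^+ 2 by rewrite !exprn_gt0.
  have pos x y : x ^+ 2 + y ^+ 2 = 1 -> 0 < p ^+ 2 * x ^+ 2 + q ^+ 2 * y ^+ 2.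
    move=> xy; have [x0|x0] := eqVneq x 0.
      by move: xy; rewrite x0 !expr0n /= !(add0r, mulr0) => ->; rewrite mulr1.
    have x2 : 0 < x ^+ 2 by rewrite exprn_even_gt0.
    by rewrite ltr_pwDl ?(mulr_gt0 p2 x2) // mulr_ge0 ?sqr_ge0.
  exists (p ^+ 2 * Re w ^+ 2 + q ^+ 2 * Im w ^+ 2).
  exists ((p ^+ 2 - q ^+ 2) * (Re w * Im w)).
  exists (p ^+ 2 * Im w ^+ 2 + q ^+ 2 * Re w ^+ 2).
  split; [exact: pos| by apply: pos; rewrite addrC| |exact: ellipse_dual].
  rewrite -subr_gt0.
  set X := (X in 0 < X); suff -> : X = (p * q) ^+ 2 * (Re w ^+ 2 + Im w ^+ 2) ^+ 2.
    by rewrite w12 expr1n mulr1 exprn_gt0 // mulr_gt0.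
  by rewrite /X; ring.
have [w w1 wE] := symmetric_diagonalization k m l.
move/normc_eq1: (w1) => w12.
(* The squared half-axes are the values of the form at the eigenvectors [w] and [i w]. *)
pose P := dual_form k m l (Re w) (Im w).
pose Q := dual_form k m l (- Im w) (Re w).
have pos x y : x ^+ 2 + y ^+ 2 = 1 -> 0 < dual_form k m l x y.
  move=> xy; rewrite -(pmulr_rgt0 _ k0).
  have -> : k * dual_form k m l x y = (k * x + m * y) ^+ 2 + (k * l - m ^+ 2) * y ^+ 2.
    by rewrite /dual_form; ring.
  have [y0|y0] := eqVneq y 0.
    move: xy; rewrite y0 expr0n /= !mulr0 !addr0 exprMn => ->.
    by rewrite mulr1 exprn_gt0.
  by rewrite ltr_wpDl ?sqr_ge0 // mulr_gt0 ?subr_gt0 // exprn_even_gt0.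
have P0 : 0 < P by apply: pos.
have Q0 : 0 < Q by apply: pos; rewrite sqrrN addrC.
exists w, (Num.sqrt P), (Num.sqrt Q); rewrite !sqrtr_gt0; split=> //.
rewrite ellipse_dual ?sqrtr_gt0 // !sqr_sqrtr ?ltW //.
move: wE w12; rewrite /P /Q /dual_form; move: (Re w) (Im w) => x y wE w12.
have d0 : m * (x ^+ 2 - y ^+ 2) - (k - l) * (x * y) = 0 by rewrite wE subrr.
(* This factor makes both sides homogeneous of degree 4 in [x] and [y]; their difference is then a
   multiple of the vanishing off-diagonal entry. *)
have unit2 z : z = z * (x ^+ 2 + y ^+ 2) ^+ 2 by rewrite w12 expr1n mulr1.
congr dual_ellipse; rewrite [LHS]unit2.
- by apply/eqP; rewrite -subr_eq0 -[X in _ == X](mulr0 (- 2 * (x * y))) -d0; apply/eqP; ring.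
- by apply/eqP; rewrite -subr_eq0 -[X in _ == X](mulr0 (x ^+ 2 - y ^+ 2)) -d0; apply/eqP; ring.
- by apply/eqP; rewrite -subr_eq0 -[X in _ == X](mulr0 (2 * (x * y))) -d0; apply/eqP; ring.
Qed.

Section DualEllipse.
Variables (R : realType) (k m l : R).
Hypotheses (k0 : 0 < k) (l0 : 0 < l) (kml : m ^+ 2 < k * l).

Lemma dual_form_ge0 c s : 0 <= dual_form k m l c s.
Proof.
rewrite -(pmulr_rge0 _ k0).
have -> : k * dual_form k m l c s = (k * c + m * s) ^+ 2 + (k * l - m ^+ 2) * s ^+ 2.
  by rewrite /dual_form; ring.
by rewrite addr_ge0 ?sqr_ge0 // mulr_ge0 ?sqr_ge0 // subr_ge0 ltW.
Qed.

Lemma dual_form_gt0 c s : (c != 0) || (s != 0) -> 0 < dual_form k m l c s.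
Proof.
move=> cs; rewrite -(pmulr_rgt0 _ k0).
have -> : k * dual_form k m l c s = (k * c + m * s) ^+ 2 + (k * l - m ^+ 2) * s ^+ 2.
  by rewrite /dual_form; ring.
have [s0|s0] := eqVneq s 0.
  move: cs; rewrite s0 expr0n /= eqxx orbF !mulr0 !addr0 => c0.
  by rewrite exprn_even_gt0 //= mulf_neq0 // gt_eqF.
have s2 : 0 < s ^+ 2 by rewrite exprn_even_gt0.
by rewrite ltr_wpDl ?sqr_ge0 // mulr_gt0 // subr_gt0.
Qed.

(** Cauchy-Schwarz for the form and its inverse: the defect is the square of [(k * c + m * s) * Y -
    (m * c + l * s) * X]. *)
Lemma dual_support_le X Y c s :
  l * X ^+ 2 - 2 * m * X * Y + k * Y ^+ 2 <= k * l - m ^+ 2 ->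
  c * X + s * Y <= Num.sqrt (dual_form k m l c s).
Proof.
move=> XY; apply: le_trans (ler_norm _) _.
rewrite -sqrtr_sqr; apply: ler_wsqrtr.
have D0 : 0 < k * l - m ^+ 2 by rewrite subr_gt0.
rewrite -(ler_pM2l D0).
have := ler_wpM2l (dual_form_ge0 c s) XY.
rewrite [X in _ <= X -> _]mulrC; apply: le_trans.
rewrite -subr_ge0.
set Z := (Z in 0 <= Z).
suff -> : Z = ((k * c + m * s) * Y - (m * c + l * s) * X) ^+ 2 by rewrite sqr_ge0.
by rewrite /Z /dual_form; ring.
Qed.

(** Equality in Cauchy-Schwarz makes [(X, Y)] parallel to the image [(U, V)] of [(c, s)] under the
    matrix of the form; the value of [c * X + s * Y] then fixes the factor. *)
Lemma dual_support_unique X Y c s :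
  (c != 0) || (s != 0) ->
  l * X ^+ 2 - 2 * m * X * Y + k * Y ^+ 2 <= k * l - m ^+ 2 ->
  c * X + s * Y = Num.sqrt (dual_form k m l c s) ->
  X * Num.sqrt (dual_form k m l c s) = k * c + m * s /\
  Y * Num.sqrt (dual_form k m l c s) = m * c + l * s.
Proof.
move=> cs XY e; have f0 := dual_form_gt0 cs.
set F := Num.sqrt _ in e *.
have F2 : F ^+ 2 = dual_form k m l c s by rewrite sqr_sqrtr ?ltW.
have F0 : F != 0 by rewrite gt_eqF ?sqrtr_gt0.
set U := k * c + m * s; set V := m * c + l * s.
have UV : (U * Y - V * X) ^+ 2 <= 0.
  have -> : (U * Y - V * X) ^+ 2 = dual_form k m l c s *
     (l * X ^+ 2 - 2 * m * X * Y + k * Y ^+ 2) - (k * l - m ^+ 2) * (c * X + s * Y) ^+ 2.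
    by rewrite /U /V /dual_form; ring.
  by rewrite e F2 subr_le0 mulrC ler_pM2r.
have {}UV : U * Y = V * X.
  apply/eqP; rewrite -subr_eq0 -sqrf_eq0; apply/eqP/le_anti.
  by rewrite UV sqr_ge0.
have FUV : F ^+ 2 = c * U + s * V by rewrite F2 /dual_form /U /V; ring.
split; apply: (mulIf F0); rewrite -mulrA -expr2 FUV -e.
  transitivity (c * X * U + s * (V * X)); [by ring|by rewrite -UV; ring].
transitivity (c * (U * Y) + s * Y * V); [by ring|by rewrite UV; ring].
Qed.

Lemma dual_support_attained o c s : exists2 z, dual_ellipse o k m l z &
  c * Re z + s * Im z = c * Re o + s * Im o + Num.sqrt (dual_form k m l c s).
Proof.
have D0 : 0 < k * l - m ^+ 2 by rewrite subr_gt0.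
wlog cs : c s / (c != 0) || (s != 0).
  (* In the zero direction any point of the ellipse will do. *)
  move=> H; have [/H //|] := boolP ((c != 0) || (s != 0)).
  rewrite negb_or !negbK => /andP[/eqP-> /eqP->].
  have [|z zE _] := H 1 0; first by rewrite oner_eq0.
  by exists z => //; rewrite /dual_form expr0n /= !(mulr0, mul0r, addr0) sqrtr0 addr0.
have f0 := dual_form_gt0 cs.
pose f := dual_form k m l c s.
have r0 : Num.sqrt f != 0 by rewrite gt_eqF ?sqrtr_gt0.
have r2 : Num.sqrt f ^+ 2 = f by rewrite sqr_sqrtr ?ltW.
(* The maximizer is the gradient of the square root of the form, translated by the center. *)
exists ((Re o + (k * c + m * s) / Num.sqrt f) +i*
        (Im o + (m * c + l * s) / Num.sqrt f)).
  rewrite /dual_ellipse /= ![_ + _ - _]addrC !addKr.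
  transitivity ((k * l - m ^+ 2) * (f / Num.sqrt f ^+ 2)).
    by rewrite /f /dual_form; field.
  by rewrite r2 divff ?mulr1 // gt_eqF.
rewrite /=; transitivity (c * Re o + s * Im o + f / Num.sqrt f).
  by rewrite /f /dual_form; field.
by congr (_ + _); apply: (mulIf r0); rewrite divfK // -expr2 r2.
Qed.

(** The separating direction is half the gradient at [(X, Y)] of the quadratic form in the
    hypothesis. If that form has value [N], the dual form in this direction is
    [(k * l - m ^+ 2) * N], which is less than [N ^+ 2]. *)
Lemma dual_separation X Y :
  k * l - m ^+ 2 < l * X ^+ 2 - 2 * m * X * Y + k * Y ^+ 2 ->
  exists c s, Num.sqrt (dual_form k m l c s) < c * X + s * Y.
Proof.
move=> XY; exists (l * X - m * Y), (k * Y - m * X).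
have D0 : 0 < k * l - m ^+ 2 by rewrite subr_gt0.
have N0 := lt_trans D0 XY.
have -> : (l * X - m * Y) * X + (k * Y - m * X) * Y =
   l * X ^+ 2 - 2 * m * X * Y + k * Y ^+ 2 by ring.
set N := (N in _ < N) in XY N0 *.
have -> : dual_form k m l (l * X - m * Y) (k * Y - m * X) = (k * l - m ^+ 2) * N.
  by rewrite /dual_form /N; ring.
by rewrite -[ltRHS]gtr0_norm // -sqrtr_sqr ltr_sqrt ?exprn_gt0 // expr2 ltr_pM2r.
Qed.

(** The horizontal chord through [z] ends on the curve: relative to the center,
    [(m * Y + e * g) / l] with [e] equal to 1 or -1 solves the quadratic equation for the
    abscissae. *)
Lemma dual_disk_convex_hull o z :
  l * (Re z - Re o) ^+ 2 - 2 * m * (Re z - Re o) * (Im z - Im o)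
           + k * (Im z - Im o) ^+ 2 <= k * l - m ^+ 2 ->
  convex_hull (dual_ellipse o k m l) z.
Proof.
case: z o => [x y] [o1 o2] /=; set X := x - o1; set Y := y - o2 => XY.
pose g := Num.sqrt ((k * l - m ^+ 2) * (l - Y ^+ 2)).
have XY' : (l * X - m * Y) ^+ 2 <= (k * l - m ^+ 2) * (l - Y ^+ 2).
  rewrite -subr_ge0; set Z := (Z in 0 <= Z).
  suff -> : Z = l * (k * l - m ^+ 2 -
     (l * X ^+ 2 - 2 * m * X * Y + k * Y ^+ 2)).
    by rewrite mulr_ge0 ?(ltW l0) // subr_ge0.
  by rewrite /Z; ring.
have g2 : g ^+ 2 = (k * l - m ^+ 2) * (l - Y ^+ 2).
  by rewrite sqr_sqrtr // (le_trans (sqr_ge0 _) XY').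
have on e : e ^+ 2 = 1 ->
    dual_ellipse (o1 +i* o2) k m l ((o1 + (m * Y + e * g) / l) +i* y).
  move=> e2; rewrite /dual_ellipse /= -/Y [o1 + _ - _]addrC addKr.
  transitivity ((e ^+ 2 * g ^+ 2 + (k * l - m ^+ 2) * Y ^+ 2) / l).
    by field; rewrite gt_eqF.
  by rewrite e2 g2; field; rewrite gt_eqF.
have : `|l * X - m * Y| <= g.
  by rewrite -sqrtr_sqr; apply: ler_wsqrtr.
rewrite ler_norml => /andP[gl gr].
apply: (@convex_set_hsegment _ _ (o1 + (m * Y + (-1) * g) / l) (o1 + (m * Y + 1 * g) / l)).
- exact: convex_hull_convex.
- by apply: sub_convex_hull; apply: on; ring.
- by apply: sub_convex_hull; apply: on; ring.
- by rewrite addrC -lerBrDr ler_pdivrMr // -/X; lra.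
- by rewrite addrC -lerBlDr ler_pdivlMr // -/X; lra.
Qed.

Lemma dual_hull_support o c s z : convex_hull (dual_ellipse o k m l) z ->
  c * Re z + s * Im z <= c * Re o + s * Im o + Num.sqrt (dual_form k m l c s).
Proof.
apply: convex_hull_halfplane => {}z zE.
have := @dual_support_le (Re z - Re o) (Im z - Im o) c s.
by rewrite zE => /(_ (lexx _)); lra.
Qed.

End DualEllipse.

(** * Convexity of the numerical range *)

Section Inner.
Variables (C : numClosedFieldType) (n : nat).
Implicit Types (x y z : 'cV[C]_n) (k : C).

Lemma innerE x y : inner x y = \sum_i x i 0 * (y i 0)^*.
Proof. by rewrite /inner dotmxE mxE; apply: eq_bigr => i _; rewrite !mxE. Qed.

Lemma innerDl x y z : inner (x + y) z = inner x z + inner y z.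
Proof. by rewrite !innerE -big_split; apply: eq_bigr => i _; rewrite mxE mulrDl. Qed.

Lemma innerDr x y z : inner x (y + z) = inner x y + inner x z.
Proof.
by rewrite !innerE -big_split; apply: eq_bigr => i _; rewrite mxE rmorphD mulrDr.
Qed.

Lemma innerZl k x y : inner (k *: x) y = k * inner x y.
Proof. by rewrite !innerE mulr_sumr; apply: eq_bigr => i _; rewrite mxE mulrA. Qed.

Lemma innerZr k x y : inner x (k *: y) = k^* * inner x y.
Proof.
by rewrite !innerE mulr_sumr; apply: eq_bigr => i _; rewrite mxE rmorphM mulrCA.
Qed.

Lemma inner_conj x y : (inner x y)^* = inner y x.
Proof.
rewrite !innerE rmorph_sum; apply: eq_bigr => i _.
by rewrite rmorphM /= conjCK mulrC.
Qed.

Lemma inner_eq0 x : inner x x = 0 -> x = 0.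
Proof.
rewrite innerE => e; apply/colP => i; rewrite mxE.
have := psumr_eq0P (fun i _ => mul_conjC_ge0 (x i 0)) e.
by move=> /(_ i isT) /eqP; rewrite mul_conjC_eq0 => /eqP.
Qed.

Lemma inner_ge0 x : 0 <= inner x x.
Proof. by rewrite innerE sumr_ge0 // => i _; apply: mul_conjC_ge0. Qed.

Lemma vnorm_eq1 x : (vnorm x = 1) <-> (inner x x = 1).
Proof.
rewrite /vnorm; split=> [e|->]; last exact: sqrtC1.
by rewrite -[LHS]sqrtCK e expr1n.
Qed.

(** Homogeneous form, so that witnesses need not be normalized. *)
Lemma numerical_range_homog (A : 'M[C]_n) (a : C) :
  numerical_range A a <->
  exists2 x, inner x x != 0 & inner (A *m x) x = a * inner x x.
Proof.
split=> [[x /vnorm_eq1 x1 ->]|[x x0 e]].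
  by exists x; rewrite x1 ?oner_eq0 ?mulr1.
pose r := sqrtC (inner x x).
have r0 : r != 0 by rewrite sqrtC_eq0.
have rr : r^-1 * (r^-1)^* * inner x x = 1.
  have -> : (r^-1)^* = r^-1.
    by apply/CrealP; rewrite rpredV ger0_real // sqrtC_ge0 inner_ge0.
  by rewrite -invfM -expr2 sqrtCK mulVf.
exists (r^-1 *: x).
  by apply/vnorm_eq1; rewrite innerZl innerZr mulrA.
by rewrite -scalemxAr innerZl innerZr e mulrCA [in RHS]mulrCA mulrA -[LHS]mulr1 -{}[in LHS]rr; ring.
Qed.


(* The key step of the Toeplitz-Hausdorff theorem: with [z1] and [z2] moved to 1
   and 0, the phase [phi] makes the form real along [s x + (1 - s) phi y]. *)
Lemma numerical_range_path (A : 'M[C]_n) x y :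
  inner x x = 1 -> inner y y = 1 -> inner (A *m x) x != inner (A *m y) y ->
  exists (path : C -> 'cV[C]_n) (kap mu nu : C),
    [/\ kap \is Num.real, mu \is Num.real, 0 <= nu &
      forall s, s \is Num.real ->
      [/\ inner (path s) (path s) != 0,
        inner (path s) (path s) = s ^+ 2 + s * (1 - s) * mu + (1 - s) ^+ 2 * nu &
        inner (A *m path s) (path s) =
        inner (A *m y) y * inner (path s) (path s)
        + (inner (A *m x) x - inner (A *m y) y) * (s ^+ 2 + s * (1 - s) * kap)]].
Proof.
move=> x1 y1; set z1 := inner _ x; set z2 := inner _ y => ne.
have d0 : z1 - z2 != 0 by rewrite subr_eq0.
pose g u v : C := (inner (A *m u) v - z2 * inner u v) / (z1 - z2).
have gE u v : inner (A *m u) v = z2 * inner u v + (z1 - z2) * g u v.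
  by rewrite /g [(z1 - z2) * _]mulrC divfK // addrC subrK.
have gx : g x x = 1 by rewrite /g -/z1 x1 mulr1 divff.
have gy : g y y = 0 by rewrite /g -/z2 y1 mulr1 subrr mul0r.
have gDl u v w : g (u + v) w = g u w + g v w.
  by rewrite /g mulmxDr !innerDl; ring.
have gDr u v w : g u (v + w) = g u v + g u w by rewrite /g !innerDr; ring.
have gZl k u v : g (k *: u) v = k * g u v.
  by rewrite /g -scalemxAr !innerZl; ring.
have gZr k u v : g u (k *: v) = k^* * g u v by rewrite /g !innerZr; ring.
clearbody g; pose w := g y x - (g x y)^*.
(* [phi * w] is real, being 0 or the squared modulus of [w]. As [phi] is not scaled to modulus 1,
   its squared modulus appears as [nu]. *)
pose phi := if w == 0 then 1 else w^*.
have phi0 : phi != 0.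
  by rewrite /phi; case: ifPn => [_|w0]; rewrite ?oner_eq0 ?conjC_eq0.
have realDconj c : c + c^* \is Num.real by apply/CrealP; rewrite rmorphD /= conjCK addrC.
pose kap := phi^* * g x y + phi * g y x.
have kap_real : kap \is Num.real.
  have -> : kap = phi * w + (phi * (g x y)^* + (phi * (g x y)^*)^*).
    by rewrite rmorphM /= conjCK /w /kap; ring.
  apply: rpredD; last exact: realDconj.
  rewrite /phi; case: ifPn => [/eqP->|_]; first by rewrite mulr0 rpred0.
  by rewrite ger0_real // mulrC mul_conjC_ge0.
pose mu := phi^* * inner x y + phi * inner y x.
have mu_real : mu \is Num.real.
  have -> : mu = phi * inner y x + (phi * inner y x)^*.
    by rewrite rmorphM /= inner_conj addrC.
  exact: realDconj.
clearbody phi; pose path s := s *: x + ((1 - s) * phi) *: y.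
exists path, kap, mu, (phi * phi^*); split=> // [|s s_real].
  exact: mul_conjC_ge0.
have sJ : s^* = s by apply/CrealP.
have s1J : (1 - s)^* = 1 - s by rewrite rmorphB rmorph1 /= sJ.
have gpath : g (path s) (path s) = s ^+ 2 + s * (1 - s) * kap.
  by rewrite /path gDl !gDr !gZl !gZr gx gy rmorphM /= sJ s1J /kap; ring.
split.
(* If the path vanished, [s *: x] would be a multiple of [y], where [g] is 0; so [s ^+ 2 = 0], and
   then [y = 0]. *)
- apply/eqP => /inner_eq0 path0.
  have sx : s *: x = - (((1 - s) * phi) *: y).
    by apply/eqP; rewrite -subr_eq0 opprK; apply/eqP.
  have : g (s *: x) (s *: x) = 0 by rewrite sx -scaleNr gZl gZr gy !mulr0.
  rewrite gZl gZr gx mulr1 sJ => /eqP; rewrite mulf_eq0 orbb => /eqP s0.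
  move: path0; rewrite /path s0 scale0r add0r subr0 mul1r => /eqP.
  rewrite scaler_eq0 (negPf phi0) /= => /eqP y0.
  by move: y1 => /eqP; rewrite y0 -(scale0r 0) innerZl mul0r eq_sym oner_eq0.
- rewrite /path innerDl !innerDr !innerZl !innerZr x1 y1 rmorphM /= sJ s1J /mu.
  ring.
- by rewrite gE gpath.
Qed.

End Inner.

Lemma numerical_range_convex (R : realType) (n : nat) (A : 'M[R[i]]_n) :
  @convex_set R (Rcomplex R) (numerical_range A).
Proof.
apply/convex_setE => z1 z2 t t0 t1 [x /vnorm_eq1 x1 z1E] [y /vnorm_eq1 y1 z2E].
have -> : (t * Re z1 + (1 - t) * Re z2) +i* (t * Im z1 + (1 - t) * Im z2)
    = z2 + (z1 - z2) * t%:C.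
  by case: z1 z2 {z1E z2E} => [a b] [c d]; simpc; congr (_ +i* _) => /=; ring.
have [e|ne] := eqVneq z1 z2.
  by rewrite e subrr mul0r addr0; exists y => //; apply/vnorm_eq1.
have ne' : inner (A *m x) x != inner (A *m y) y by rewrite -z1E -z2E.
have [path [_ [_ [nu [/complex_realP[kap ->] /complex_realP[mu ->]] nu0 pathP]]]] :=
  numerical_range_path x1 y1 ne'.
have /complex_realP[nu' nuE] := ger0_real nu0.
move: nu0; rewrite {}nuE ler0c in pathP * => {nu} nu0.
(* At a root of [p] the normalized value of the form is [t]. The intermediate value theorem applies
   since [p] is [- t * nu'] at 0 and [1 - t] at 1. *)
pose p : {poly R} := 'X ^+ 2 + kap *: ('X * (1 - 'X))
   - t *: ('X ^+ 2 + mu *: ('X * (1 - 'X)) + nu' *: (1 - 'X) ^+ 2).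
have pE s : p.[s] = s ^+ 2 + s * (1 - s) * kap
   - t * (s ^+ 2 + s * (1 - s) * mu + (1 - s) ^+ 2 * nu').
  by rewrite /p !(hornerE, horner_exp) /=; ring.
have [s _ /rootP ps] : exists2 s, 0 <= s <= 1 & root p s.
  apply: poly_ivt; first exact: ler01.
  rewrite !pE; have := mulr_ge0 t0 nu0.
  by rewrite -subr_ge0 in t1; lra.
have [|N0 NE fE] := pathP s%:C; first by rewrite complex_real.
apply/numerical_range_homog; exists (path s%:C) => //.
rewrite fE -z1E -z2E [RHS]mulrDl; congr (_ + _); rewrite -[RHS]mulrA; congr (_ * _).
rewrite NE -[1]/(1%:C) -!rmorphB -!rmorphXn -!rmorphM -!rmorphD -rmorphM.
by congr (_%:C); apply/eqP; rewrite -subr_eq0 -pE ps.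
Qed.

(** * Real coordinates and support function of the numerical range *)

Definition block_matrix (R : realType) (u b : R) (b1 b2 : R[i]) : 'M[R[i]]_4 :=
  mx_of_rows 4 4
    [:: [:: u%:C      ; 0          ; b1^* + 1   ; 0         ];
        [:: 0         ; u%:C       ; b%:C       ; b2^* + 1  ];
        [:: b1 - 1    ; b%:C       ; - u%:C     ; 0         ];
        [:: 0         ; b2 - 1     ; 0          ; - u%:C    ]].

Section RealForms.
Variables (R : realType) (u b : R) (b1 b2 : R[i]).
Implicit Types x y : R[i] * R[i].

Definition sqabs (z : R[i]) : R := Re z ^+ 2 + Im z ^+ 2.
Definition redot (z w : R[i]) : R := Re z * Re w + Im z * Im w.
Definition sqnorm x : R := sqabs x.1 + sqabs x.2.

(** The Hermitian part of the matrix has diagonal blocks [u], [- u] and lower left block [B] with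
    rows [b1, b] and [0, b2]. The skew part comes from the entries 1 and -1 only, with lower left
    block the identity times ['i] after division by ['i]. *)
Definition re_form x y : R :=
  u * (sqnorm x - sqnorm y)
  + 2 * (redot (b1 * x.1 + b%:C * x.2) y.1 + redot (b2 * x.2) y.2).
Definition im_form x y : R := 2 * (redot ('i * x.1) y.1 + redot ('i * x.2) y.2).

Lemma numerical_range_blockP z :
  numerical_range (block_matrix u b b1 b2) z <->
  exists x y, [/\ sqnorm x + sqnorm y != 0,
    re_form x y = Re z * (sqnorm x + sqnorm y) &
    im_form x y = Im z * (sqnorm x + sqnorm y)].
Proof.
have key (v : 'cV_4) (x := (v 0 0, v 1 0)) (y := (v 2%:R 0, v 3%:R 0)) :
  inner v v = (sqnorm x + sqnorm y)%:C /\
  inner (block_matrix u b b1 b2 *m v) v = re_form x y +i* im_form x y.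
  have o1 : lift ord0 ord0 = 1 :> 'I_4 by apply/val_inj.
  have o2 : lift ord0 (lift ord0 ord0) = 2%:R :> 'I_4 by apply/val_inj.
  have o3 : lift ord0 (lift ord0 (lift ord0 ord0)) = 3%:R :> 'I_4 by apply/val_inj.
  rewrite !innerE !big_ord_recl !big_ord0 !mxE !big_ord_recl !big_ord0 !mxE /=.
  rewrite !(o3, o2, o1) /x /y /re_form /im_form /sqnorm /redot /sqabs /=.
  have conjE (c : R[i]) : Num.conj c = Re c -i* Im c by case: c.
  rewrite !conjE.
  move: (v 0 0) (v 1 0) (v 2%:R 0) (v 3%:R 0) => [v1 w1] [v2 w2] [v3 w3] [v4 w4].
  case: b1 b2 => [xi1 eta1] [xi2 eta2].
  by split; apply/eqP; rewrite eq_complex; apply/andP; split; apply/eqP;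
    rewrite /=; ring.
rewrite (numerical_range_homog (block_matrix u b b1 b2)); split=> [[v]|[x [y [xy0 reE imE]]]].
  have [-> ->] := key v => v0 e.
  exists (v 0 0, v 1 0), (v 2%:R 0, v 3%:R 0); split.
  - by apply: contra v0 => /eqP->.
  - by move/(congr1 (@Re R)): e; case: z => z1 z2; rewrite /= mulr0 subr0.
  - by move/(congr1 (@Im R)): e; case: z => z1 z2; rewrite /= mulr0 add0r.
pose v : 'cV[R[i]]_4 := \col_i nth 0 [:: x.1; x.2; y.1; y.2] i.
have [] := key v; rewrite !mxE /= -!surjective_pairing => e1 e2.
exists v; first by rewrite e1 -[0]/(0%:C) (inj_eq (@complexI _)).
rewrite e1 e2 reE imE; case: z {reE imE} => z1 z2.
by apply/eqP; rewrite eq_complex /= mulr0 subr0 mulr0 add0r !eqxx.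
Qed.
End RealForms.

Lemma ler_amgm_of_sqr (R : realDomainType) (a b z : R) :
  0 <= a -> 0 <= b -> z ^+ 2 <= a * b -> 2 * z <= a + b.
Proof.
move=> a0 b0 zab; apply: le_trans (ler_norm _) _.
rewrite -(ler_pXn2r (n := 2)) ?nnegrE ?addr_ge0 // real_normK ?num_real //.
by have := sqr_ge0 (a - b); lra.
Qed.

(** * The support function as a largest eigenvalue *)

Section Support.
Variables (R : realType) (u b : R) (b1 b2 : R[i]).
Implicit Types (c s : R) (x y : R[i] * R[i]).

(** For [z] equal to [b1] or [b2], a diagonal entry of [M = c B + i s]. *)
Definition pencil (z : R[i]) c s : R[i] := (c * Re z) +i* (c * Im z + s).

(** [c ^+ 2 * disc c s] is the discriminant of the characteristic polynomial of [M^* M]. The factor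
    [c ^+ 2] splits off because the squared moduli of the two diagonal entries of [M] differ by a
    multiple of [c]. *)
Definition disc c s : R :=
  (c * (sqabs b1 - sqabs b2) + 2 * s * (Im b1 - Im b2)) ^+ 2
  + 2 * b ^+ 2 * (sqabs (pencil b1 c s) + sqabs (pencil b2 c s))
  + c ^+ 2 * b ^+ 4.

(* The largest eigenvalue of [M^* M], where [M] is the lower left block of
   [c Re A + s Im A]. *)
Definition sval2 c s : R :=
  (sqabs (pencil b1 c s) + sqabs (pencil b2 c s) + c ^+ 2 * b ^+ 2
   + `|c| * Num.sqrt (disc c s)) / 2.

Definition nr_support c s : R := Num.sqrt (c ^+ 2 * u ^+ 2 + sval2 c s).

Lemma sqabs_ge0 (z : R[i]) : 0 <= sqabs z.
Proof. by rewrite addr_ge0 ?sqr_ge0. Qed.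

Lemma sqabs0 : sqabs (0 : R[i]) = 0.
Proof. by rewrite /sqabs /= expr0n addr0. Qed.

Lemma sqabs1 : sqabs (1 : R[i]) = 1.
Proof. by rewrite /sqabs /= expr1n expr0n addr0. Qed.

Lemma disc_ge0 c s : 0 <= disc c s.
Proof.
have b4 : 0 <= b ^+ 4 by rewrite exprn_even_ge0.
have b2' : 0 <= 2 * b ^+ 2 by rewrite mulr_ge0 ?sqr_ge0.
apply: addr_ge0; last by rewrite mulr_ge0 ?sqr_ge0.
apply: addr_ge0; first exact: sqr_ge0.
by apply: mulr_ge0 => //; rewrite addr_ge0 ?sqabs_ge0.
Qed.

(** The characteristic equation of [M^* M]. *)
Lemma sval2_char c s :
  (sval2 c s - sqabs (pencil b1 c s))
  * (sval2 c s - sqabs (pencil b2 c s) - c ^+ 2 * b ^+ 2)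
  = sqabs (pencil b1 c s) * (c ^+ 2 * b ^+ 2).
Proof.
have r2 : (`|c| * Num.sqrt (disc c s)) ^+ 2 = c ^+ 2 * disc c s.
  by rewrite exprMn real_normK ?num_real // sqr_sqrtr ?disc_ge0.
rewrite /sval2; set r := `|c| * _ in r2 *.
set P := sqabs _; set Q := sqabs (pencil b2 c s).
transitivity ((r ^+ 2 - (P - Q - c ^+ 2 * b ^+ 2) ^+ 2) / 4); first by field.
rewrite r2; have PQ : P - Q = c * (c * (sqabs b1 - sqabs b2) + 2 * s * (Im b1 - Im b2)).
  by rewrite /P /Q /sqabs /=; ring.
have -> : c ^+ 2 * disc c s = (P - Q) ^+ 2
    + c ^+ 2 * (2 * b ^+ 2 * (P + Q) + c ^+ 2 * b ^+ 4) by rewrite PQ /disc -/P -/Q; ring.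
by field.
Qed.

(** The two numbers have a nonnegative product by [sval2_char], and their sum is [|c|] times the
    square root of [disc c s]. *)
Lemma sval2_ge c s :
  0 <= sval2 c s - sqabs (pencil b1 c s) /\
  0 <= sval2 c s - sqabs (pencil b2 c s) - c ^+ 2 * b ^+ 2.
Proof.
have := sval2_char c s.
set A1 := _ - _; set A2 := _ - _ - _ => A12.
have prod : 0 <= A1 * A2.
  by rewrite A12 -exprMn mulr_ge0 ?sqabs_ge0 ?sqr_ge0.
have sum : 0 <= A1 + A2.
  have -> : A1 + A2 = `|c| * Num.sqrt (disc c s) by rewrite /A1 /A2 /sval2; field.
  by rewrite mulr_ge0 ?sqrtr_ge0.
split; rewrite leNgt; apply/negP => neg; nra.
Qed.

Lemma sval2_ge0 c s : 0 <= sval2 c s.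
Proof.
by have [h _] := sval2_ge c s; have := sqabs_ge0 (pencil b1 c s); lra.
Qed.

Lemma nr_support_sqr c s : nr_support c s ^+ 2 = c ^+ 2 * u ^+ 2 + sval2 c s.
Proof. by rewrite sqr_sqrtr // addr_ge0 ?sval2_ge0 // mulr_ge0 ?sqr_ge0. Qed.

Definition pencil_mul c s x : R[i] * R[i] :=
  (pencil b1 c s * x.1 + (c * b)%:C * x.2, pencil b2 c s * x.2).

Lemma pencil_formE c s x y :
  c * re_form u b b1 b2 x y + s * im_form x y =
  c * u * (sqnorm x - sqnorm y)
  + 2 * (redot (pencil_mul c s x).1 y.1 + redot (pencil_mul c s x).2 y.2).
Proof.
move: x y => [[x1 x2] [x3 x4]] [[y1 y2] [y3 y4]].
rewrite /re_form /im_form /redot /pencil_mul /pencil /=.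
by case: b1 b2 => [xi1 eta1] [xi2 eta2] /=; ring.
Qed.

Lemma sqnorm_ge0 x : 0 <= sqnorm x.
Proof. by rewrite addr_ge0 ?sqabs_ge0. Qed.

Lemma sqabsM (z w : R[i]) : sqabs (z * w) = sqabs z * sqabs w.
Proof. by case: z w => [a b'] [c d]; rewrite /sqabs /=; ring. Qed.

Lemma redot_sqr_le (z w : R[i]) : redot z w ^+ 2 <= sqabs z * sqabs w.
Proof.
rewrite -subr_ge0; have -> : sqabs z * sqabs w - redot z w ^+ 2 =
   (Re z * Im w - Im z * Re w) ^+ 2 by rewrite /sqabs /redot; ring.
exact: sqr_ge0.
Qed.

Lemma redot2_sqr_le x y :
  (redot x.1 y.1 + redot x.2 y.2) ^+ 2 <= sqnorm x * sqnorm y.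
Proof.
have h1 := redot_sqr_le x.1 y.1; have h2 := redot_sqr_le x.2 y.2.
have := @ler_amgm_of_sqr R (sqabs x.1 * sqabs y.2) (sqabs x.2 * sqabs y.1)
  (redot x.1 y.1 * redot x.2 y.2).
rewrite !mulr_ge0 ?sqabs_ge0 // exprMn => /(_ isT isT).
have : redot x.1 y.1 ^+ 2 * redot x.2 y.2 ^+ 2 <=
  sqabs x.1 * sqabs y.2 * (sqabs x.2 * sqabs y.1).
  apply: le_trans (ler_pM (sqr_ge0 _) (sqr_ge0 _) h1 h2) _.
  by rewrite le_eqVlt; apply/orP; left; apply/eqP; ring.
by move=> h /(_ h); rewrite /sqnorm; lra.
Qed.

(** [sval2 c s - M^* M] is positive semidefinite: its diagonal entries are nonnegative by [sval2_ge]
    and its determinant is 0 by [sval2_char]. *)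
Lemma pencil_mul_le c s x :
  sqnorm (pencil_mul c s x) <= sval2 c s * sqnorm x.
Proof.
have [A1 A2] := sval2_ge c s; have A12 := sval2_char c s.
set b1' := pencil b1 c s in A1 A12; set b2' := pencil b2 c s in A2 A12.
have E : sval2 c s * sqnorm x - sqnorm (pencil_mul c s x) =
  (sval2 c s - sqabs b1') * sqabs x.1
  + (sval2 c s - sqabs b2' - c ^+ 2 * b ^+ 2) * sqabs x.2
  - 2 * (redot (b1' * x.1) ((c * b)%:C * x.2)).
  rewrite /sqnorm /pencil_mul /= sqabsM -/b2' -/b1'.
  move: (b1') (b2') (sval2 c s) => [p q] z v.
  by case: x => [[x1 x2] [x3 x4]]; rewrite /sqabs /redot /=; ring.
rewrite -subr_ge0 {}E subr_ge0.
apply: ler_amgm_of_sqr; rewrite ?mulr_ge0 ?sqabs_ge0 //.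
rewrite mulrACA A12; apply: le_trans (redot_sqr_le _ _) _.
rewrite !sqabsM le_eqVlt; apply/orP; left; apply/eqP.
by rewrite [sqabs (_%:C)]/sqabs /=; ring.
Qed.

(** With [a = c * u], the product of [h - a] and [h + a] is [sval2 c s], which bounds the squared
    norm of [M]; Cauchy-Schwarz and the inequality of means conclude. *)
Lemma nr_support_le c s x y :
  c * re_form u b b1 b2 x y + s * im_form x y
    <= nr_support c s * (sqnorm x + sqnorm y).
Proof.
rewrite pencil_formE; set h := nr_support c s; set a := c * u.
have h2 : h ^+ 2 = a ^+ 2 + sval2 c s by rewrite nr_support_sqr exprMn.
have ha : `|a| <= h.
  by rewrite -sqrtr_sqr ler_wsqrtr // exprMn lerDl sval2_ge0.
move: ha; rewrite ler_norml => /andP[ha1 ha2].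
set t := redot _ _ + redot _ _.
suff : 2 * t <= (h - a) * sqnorm x + (h + a) * sqnorm y by lra.
apply: ler_amgm_of_sqr; rewrite ?mulr_ge0 ?sqnorm_ge0 //; try lra.
apply: le_trans (redot2_sqr_le _ _) _.
have -> : (h - a) * sqnorm x * ((h + a) * sqnorm y) =
  (h ^+ 2 - a ^+ 2) * sqnorm x * sqnorm y by ring.
rewrite ler_wpM2r ?sqnorm_ge0 // h2 [a ^+ 2 + _]addrC addrK.
exact: pencil_mul_le.
Qed.

Lemma sqnorm_eq0 x : sqnorm x = 0 -> x.1 = 0 /\ x.2 = 0.
Proof.
move/eqP; rewrite paddr_eq0 ?sqabs_ge0 // /sqabs !paddr_eq0 ?sqr_ge0 // !sqrf_eq0.
case: x => [[x1 x2] [x3 x4]] /= /andP[/andP[/eqP-> /eqP->] /andP[/eqP-> /eqP->]].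
by [].
Qed.

Lemma pencil_mul_attained c s :
  exists2 x, sqnorm x != 0 & sqnorm (pencil_mul c s x) = sval2 c s * sqnorm x.
Proof.
have A12 := sval2_char c s; move: A12.
set A1 := sval2 c s - _; set v := sval2 c s.
set z := pencil b1 c s => A12.
(* If [A1 = 0], the eigenvalue is the first diagonal entry of [M^* M], and the first basis vector
   attains it. *)
have [A10|A10] := eqVneq A1 0.
  exists (1, 0); first by rewrite /sqnorm sqabs1 sqabs0 addr0 oner_eq0.
  rewrite /pencil_mul /sqnorm /= -/z !sqabsM !mulr0 sqabs1 sqabs0 !mulr0 !addr0 !mulr1.
  by apply/eqP; rewrite eq_sym -subr_eq0; apply/eqP.
(* This vector solves the first row of the eigenvalue equation of [M^* M]. *)
exists ((z^* * (c * b)%:C), A1%:C).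
  apply/eqP => /sqnorm_eq0[_] /= [e]; by rewrite e eqxx in A10.
have -> : sqnorm (pencil_mul c s (z^* * (c * b)%:C, A1%:C)) =
    (c * b) ^+ 2 * (sqabs z + A1) ^+ 2 + sqabs (pencil b2 c s) * A1 ^+ 2.
  rewrite /sqnorm /pencil_mul /= sqabsM -/z; congr (_ + _ * _).
    by case: (z) => p q; rewrite /sqabs /=; ring.
  by rewrite /sqabs /= expr0n addr0.
have -> : sqnorm (z^* * (c * b)%:C, A1%:C) = sqabs z * (c * b) ^+ 2 + A1 ^+ 2.
  by rewrite /sqnorm /sqabs /=; case: (z) => p q /=; ring.
have vE : v = A1 + sqabs z by rewrite /A1 subrK.
move: A12; rewrite vE -exprMn; move: (sqabs z) (sqabs (pencil b2 c s)) (c * b) => P Q e A12.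
apply/eqP; rewrite -subr_eq0.
have -> : e ^+ 2 * (P + A1) ^+ 2 + Q * A1 ^+ 2 - (A1 + P) * (P * e ^+ 2 + A1 ^+ 2) =
   A1 * (P * e ^+ 2 - A1 * (A1 + P - Q - e ^+ 2)) by ring.
by rewrite A12 subrr mulr0.
Qed.

Lemma nr_support_attained c s : exists x y, sqnorm x + sqnorm y != 0 /\
  c * re_form u b b1 b2 x y + s * im_form x y
  = nr_support c s * (sqnorm x + sqnorm y).
Proof.
set h := nr_support c s; set a := c * u.
have h0 : 0 <= h by apply: sqrtr_ge0.
have h2 : h ^+ 2 = a ^+ 2 + sval2 c s by rewrite nr_support_sqr exprMn.
have n0 : sqnorm ((0, 0) : R[i] * R[i]) = 0.
  by rewrite /sqnorm sqabs0 addr0.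
have n1 : sqnorm ((1, 0) : R[i] * R[i]) = 1.
  by rewrite /sqnorm sqabs1 sqabs0 addr0.
(* Here [h = - a] is the eigenvalue on the lower block, and the general eigenvector
   [((a + h) x, M x)] may vanish. *)
have [ah|ah] := eqVneq (a + h) 0.
  exists (0, 0), (1, 0); rewrite n0 n1 add0r oner_eq0; split=> //.
  rewrite pencil_formE n0 n1 -/a /pencil_mul /redot /=; lra.
have [x x0 xE] := pencil_mul_attained c s.
pose y := pencil_mul c s x; pose x' := ((a + h)%:C * x.1, (a + h)%:C * x.2).
have nx' : sqnorm x' = (a + h) ^+ 2 * sqnorm x.
  by rewrite /sqnorm /x' !sqabsM /sqabs /=; ring.
have dotE : redot (pencil_mul c s x').1 y.1 + redot (pencil_mul c s x').2 y.2
    = (a + h) * sqnorm y.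
  rewrite /y /x' /pencil_mul /sqnorm /sqabs /redot /=.
  move: (pencil b1 c s) (pencil b2 c s) (x.1) (x.2) => [p1 q1] [p2 q2] [x1 x2] [x3 x4] /=.
  by ring.
have hpos : h != 0.
  apply: contra ah => /eqP h00; move: h2; rewrite h00 expr0n => /esym/eqP.
  rewrite paddr_eq0 ?sqr_ge0 ?sval2_ge0 // sqrf_eq0 => /andP[/eqP-> _].
  by rewrite addr0.
have nyE : sqnorm y = (h ^+ 2 - a ^+ 2) * sqnorm x by rewrite xE h2 addrC addKr.
have nE : sqnorm x' + sqnorm y = 2 * h * (a + h) * sqnorm x.
  by rewrite nx' nyE; ring.
exists x', y; split; first by rewrite nE !mulf_neq0 ?pnatr_eq0.
rewrite pencil_formE -/a dotE nE nx' nyE; ring.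
Qed.

Lemma numerical_range_support_le c s z :
  numerical_range (block_matrix u b b1 b2) z ->
  c * Re z + s * Im z <= nr_support c s.
Proof.
move=> /numerical_range_blockP[x [y [n0 reE imE]]].
have := nr_support_le c s x y; rewrite reE imE !mulrA -mulrDl ler_pM2r //.
by rewrite lt_neqAle eq_sym n0 addr_ge0 ?sqnorm_ge0.
Qed.

Lemma numerical_range_support_attained c s :
  exists2 z, numerical_range (block_matrix u b b1 b2) z &
    c * Re z + s * Im z = nr_support c s.
Proof.
have [x [y [n0 e]]] := nr_support_attained c s.
exists ((re_form u b b1 b2 x y / (sqnorm x + sqnorm y)) +i*
        (im_form x y / (sqnorm x + sqnorm y))).
  by apply/numerical_range_blockP; exists x, y; rewrite /= !divfK.
by rewrite /= [c * _]mulrA [s * _]mulrA -mulrDl e mulfK.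
Qed.

End Support.

(** * Necessity *)

(* Comparing the multiplicities of [z], which are even in [a ^+ 2] and odd in
   [d ^+ 2 * q]. *)
Lemma sqr_eq_sqrM_quadratic (F : fieldType) (a d : {poly F}) (l z w : F) :
  l != 0 -> z != w ->
  a ^+ 2 = d ^+ 2 * (l *: (('X - z%:P) * ('X - w%:P))) -> d = 0.
Proof.
move=> l0 zw e; apply/eqP; apply: contraT => d0.
set q := l *: _ in e.
have q0 : q != 0 by rewrite scaler_eq0 (negPf l0) mulf_neq0 ?polyXsubC_eq0.
have a0 : a != 0.
  by apply: contraTneq (mulf_neq0 (expf_neq0 2 d0) q0) => a0; rewrite -e a0 expr0n eqxx.
have sq0 : d ^+ 2 != 0 by rewrite expf_neq0.
have mq : mup z q = 1%N.
  rewrite /q -mul_polyC mupMr ?rootC // mupMl ?root_XsubC //.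
  by rewrite -['X - _]expr1 mup_XsubCX eqxx.
have : mup z (a ^+ 2) = mup z (d ^+ 2 * q) by rewrite e.
rewrite mupM // mq !expr2 !mupM // => /(congr1 odd).
by rewrite !oddD !addbb.
Qed.

Lemma quadratic_factorsE (F : fieldType) (l z w : F) :
  l *: (('X - z%:P) * ('X - w%:P)) =
  (l * (z * w))%:P + (- (l * (z + w))) *: 'X + l *: 'X^2.
Proof. by rewrite -!mul_polyC !(polyCM, polyCD, polyCN); ring. Qed.

(** Equally spaced points of the interval give more zeros than the size of [p]. *)
Lemma poly_itv_eq0 (R : realFieldType) (p : {poly R}) (s0 tau : R) :
  0 < tau -> (forall s, s0 <= s -> s < s0 + tau -> p.[s] = 0) -> p = 0.
Proof.
move=> tau0 p0; apply/eqP; apply: contraT => pn0.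
pose n := (size p).+1; pose f (i : nat) := s0 + tau * (i%:R / n%:R).
have n0 : 0 < n%:R :> R by rewrite ltr0n.
have : (size (mkseq f n) < size p)%N.
  apply: max_poly_roots => //.
    apply/allP => v; rewrite /mkseq => /mapP[j]; rewrite mem_iota add0n => /= j_n ->.
    apply/rootP/p0; rewrite /f ?lerDl ?mulr_ge0 ?invr_ge0 ?ler0n ?(ltW tau0) //.
    by rewrite ltrD2l gtr_pMr // ltr_pdivrMr // mul1r ltr_nat.
  rewrite mkseq_uniq // => i j /addrI /(mulfI (lt0r_neq0 tau0)).
  by move/(mulIf (invr_neq0 (lt0r_neq0 n0)))/eqP; rewrite eqr_nat => /eqP.
by rewrite size_mkseq ltnNge leqnSn.
Qed.

(** Isolating the root and squaring gives [al ^+ 2 = de ^+ 2 * q], first on the interval and hence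
    as polynomials. Since [q] has two distinct conjugate roots over [R[i]], [sqr_eq_sqrM_quadratic]
    applies there. *)
Lemma dual_sqrt_indep (R : realType) (k m l c : R) (al de : {poly R}) (s0 tau : R) :
  0 < k -> 0 < l -> m ^+ 2 < k * l -> c != 0 -> 0 < tau ->
  (forall s, s0 <= s -> s < s0 + tau ->
     al.[s] + de.[s] * Num.sqrt (dual_form k m l c s) = 0) ->
  al = 0 /\ de = 0.
Proof.
move=> k0 l0 kml c0 tau0 H.
pose q : {poly R} := (k * c ^+ 2)%:P + (2 * m * c) *: 'X + l *: 'X ^+ 2.
have qE s : q.[s] = dual_form k m l c s.
  by rewrite /q /dual_form !(hornerE, horner_exp) /=; ring.
have sqE : al ^+ 2 = de ^+ 2 * q.
  apply/eqP; rewrite -subr_eq0; apply/eqP/(@poly_itv_eq0 _ _ s0 tau) => // s s1 s2.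
  rewrite hornerD hornerN horner_exp hornerM horner_exp qE.
  rewrite -[dual_form _ _ _ _ _]sqr_sqrtr ?dual_form_ge0 // -exprMn.
  by rewrite subr_sqr H // mulr0.
have de0 : de = 0.
  pose rt : R := c * Num.sqrt (k * l - m ^+ 2) / l.
  pose z : R[i] := (- (m * c / l)) +i* rt.
  pose w : R[i] := (- (m * c / l)) +i* (- rt).
  have D0 : 0 < k * l - m ^+ 2 by rewrite subr_gt0.
  have rt0 : rt != 0.
    by rewrite !mulf_neq0 ?invr_eq0 // gt_eqF ?sqrtr_gt0.
  have rt2 : rt ^+ 2 = c ^+ 2 * (k * l - m ^+ 2) / l ^+ 2.
    by rewrite /rt !exprMn sqr_sqrtr ?ltW // exprVn.
  have zw : z != w.
    rewrite eq_complex /= eqxx /= -subr_eq0 opprK -mulr2n -mulr_natl.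
    by rewrite mulf_neq0 ?pnatr_eq0.
  have lC : l%:C != 0 :> R[i] by rewrite (inj_eq (@complexI _) l 0) gt_eqF.
  apply: (map_inj_poly (@complexI R) (rmorph0 _)); rewrite map_poly0.
  apply: (@sqr_eq_sqrM_quadratic _ (map_poly (real_complex R) al) _ _ _ _ lC zw).
  rewrite -rmorphXn sqE rmorphM rmorphXn; congr (_ * _).
  rewrite /q !rmorphD /= !map_polyZ /= map_polyXn map_polyX map_polyC /=.
  rewrite quadratic_factorsE; congr (_%:P + _ *: _ + _); rewrite /z /w;
    apply/eqP; rewrite eq_complex; apply/andP; split; apply/eqP => /=.
  - transitivity (l * ((m * c / l) ^+ 2 + rt ^+ 2)); last by ring.
    by rewrite rt2; field; rewrite gt_eqF.
  - by ring.
  - by field; rewrite gt_eqF.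
  - by ring.
split=> //; move: sqE; rewrite de0 expr0n mul0r => /eqP.
by rewrite sqrf_eq0 => /eqP.
Qed.

(** The coefficients determine [y], [l], [m], [k] and [x ^+ 2]. What remains gives (i) when the
    imaginary parts of [b1] and [b2] agree, and (ii) otherwise. *)
Lemma support_identities_coef (R : realType) (u b : R) (b1 b2 : R[i])
    (k m l x y c : R) :
  0 < k -> 0 < l -> m ^+ 2 < k * l -> c != 0 -> (x != 0) || (y != 0) ->
  (forall s, (c * x + s * y) ^+ 2 + dual_form k m l c s =
     c ^+ 2 * u ^+ 2
     + (sqabs (pencil b1 c s) + sqabs (pencil b2 c s) + c ^+ 2 * b ^+ 2) / 2) ->
  (forall s, 16 * (c * x + s * y) ^+ 2 * dual_form k m l c s =
     c ^+ 2 * disc b b1 b2 c s) ->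
  b <> 0 /\
  ((Im b1 = Im b2 /\ 4 * b ^+ 2 * u ^+ 2 = (Re b1 ^+ 2 - Re b2 ^+ 2) ^+ 2) \/
   (u = 0 /\ Re b1 = 0 /\ Re b2 = 0)).
Proof.
case: b1 b2 => [xi1 eta1] [xi2 eta2] /= k0 l0 kml c0 xy H1 H2.
pose De := xi1 ^+ 2 + eta1 ^+ 2 - (xi2 ^+ 2 + eta2 ^+ 2).
pose de := eta1 - eta2.
pose N := xi1 ^+ 2 + eta1 ^+ 2 + (xi2 ^+ 2 + eta2 ^+ 2).
(* Putting [s = c * t] removes [c] from both identities. *)
have {}H1 t : (x + t * y) ^+ 2 + (k + 2 * m * t + l * t ^+ 2)
    = u ^+ 2 + (N + b ^+ 2) / 2 + (eta1 + eta2) * t + t ^+ 2.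
  apply: (mulfI (expf_neq0 2 c0)); have := H1 (c * t).
  rewrite /sqabs /dual_form /N /= => H.
  transitivity ((c * x + c * t * y) ^+ 2
    + (k * c ^+ 2 + 2 * m * c * (c * t) + l * (c * t) ^+ 2)); first by ring.
  by rewrite H; field.
have {}H2 t : 16 * (x + t * y) ^+ 2 * (k + 2 * m * t + l * t ^+ 2)
    = (De + 2 * t * de) ^+ 2 + 2 * b ^+ 2 * (N + 2 * (eta1 + eta2) * t + 2 * t ^+ 2)
      + b ^+ 4.
  apply: (mulfI (expf_neq0 4 c0)); have := H2 (c * t).
  rewrite /disc /sqabs /dual_form /N /De /de /= => H.
  transitivity (16 * (c * x + c * t * y) ^+ 2
    * (k * c ^+ 2 + 2 * m * c * (c * t) + l * (c * t) ^+ 2)); first by ring.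
  by rewrite H; ring.
(* The coefficient of [t ^+ 4], extracted from five values; the right side of [H2] has degree at
   most 2. *)
have y0 : y = 0.
  have : y ^+ 2 * l = 0.
    have := H2 0; have := H2 1; have := H2 (-1); have := H2 2; have := H2 (-2).
    lra.
  by move/eqP; rewrite mulf_eq0 (gt_eqF l0) orbF sqrf_eq0 => /eqP.
move: xy H1 H2; rewrite {}y0 eqxx orbF => x0 H1 H2.
have l1 : l = 1 by have := H1 0; have := H1 1; have := H1 (-1); lra.
have mE : 2 * m = eta1 + eta2 by have := H1 1; have := H1 (-1); lra.
have kE : k = u ^+ 2 + (N + b ^+ 2) / 2 - x ^+ 2 by have := H1 0; lra.
have xE : 4 * x ^+ 2 = de ^+ 2 + b ^+ 2.
  by have := H2 0; have := H2 1; have := H2 (-1); rewrite l1; lra.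
have MM : 8 * x ^+ 2 * m = De * de + b ^+ 2 * (eta1 + eta2).
  by have := H2 1; have := H2 (-1); rewrite l1; lra.
have KK : 16 * x ^+ 2 * k = De ^+ 2 + 2 * b ^+ 2 * N + b ^+ 4.
  by have := H2 0; lra.
have x2 : 0 < x ^+ 2 by rewrite exprn_even_gt0.
have [de0|de0] := eqVneq de 0.
  have b0 : b != 0 by apply: contraTneq x2 => b0; move: xE; rewrite de0 b0; lra.
  split; first exact/eqP.
  left; have e12 : eta1 = eta2 by apply/eqP; rewrite -subr_eq0 -/de de0.
  split=> //; move: KK; rewrite kE.
  have -> : 16 * x ^+ 2 = 4 * b ^+ 2 by move: xE; rewrite de0; lra.
  have -> : x ^+ 2 = b ^+ 2 / 4 by move: xE; rewrite de0; lra.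
  by rewrite /De e12; lra.
have xi12 : xi1 ^+ 2 = xi2 ^+ 2.
  have : de * (xi1 ^+ 2 - xi2 ^+ 2) = 0.
    have : 2 * (4 * x ^+ 2) * (2 * m) = 2 * (De * de + b ^+ 2 * (eta1 + eta2)).
      by rewrite -MM; ring.
    by rewrite xE mE /De /de; lra.
  by move/eqP; rewrite mulf_eq0 (negPf de0) subr_eq0 => /eqP.
have DeE : De = de * (eta1 + eta2) by rewrite /De /de xi12; ring.
(* If [b = 0], the identities force [k = m ^+ 2] with [l = 1], and the form is degenerate. *)
have b0 : b != 0.
  apply/eqP => b0; move: xE MM KK kml; rewrite b0 l1 mulr1 => xE MM KK.
  have e2 : 2 * de * m = De.
    apply: (mulfI de0); transitivity (2 * (4 * x ^+ 2) * m); first by rewrite xE; ring.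
    by transitivity (8 * x ^+ 2 * m); [ring|rewrite MM; ring].
  have : 4 * de ^+ 2 * k = 4 * de ^+ 2 * m ^+ 2.
    transitivity (De ^+ 2); last by rewrite -e2; ring.
    transitivity (4 * (4 * x ^+ 2) * k); first by rewrite xE; ring.
    by transitivity (16 * x ^+ 2 * k); [ring|rewrite KK; ring].
  have d20 : 4 * de ^+ 2 != 0 by rewrite mulf_neq0 ?pnatr_eq0 ?expf_neq0.
  by move/(mulfI d20) => ->; rewrite ltxx.
split; first exact/eqP.
right.
have d2 : 0 < de ^+ 2 by rewrite exprn_even_gt0.
have b2 : 0 < b ^+ 2 by rewrite exprn_even_gt0.
(* A vanishing sum of nonnegative terms, with [de] and [b] nonzero. *)
have key : de ^+ 2 * (u ^+ 2 + xi2 ^+ 2) + b ^+ 2 * u ^+ 2 = 0.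
  have : 4 * (4 * x ^+ 2) * k = De ^+ 2 + 2 * b ^+ 2 * N + b ^+ 4.
    by rewrite -KK; ring.
  have -> : k = u ^+ 2 + (N + b ^+ 2) / 2 - (4 * x ^+ 2) / 4.
    by rewrite kE; field.
  by rewrite xE DeE /N xi12 /de; lra.
have u2 := sqr_ge0 u; have x22 := sqr_ge0 xi2.
have [u20 xi20] : u ^+ 2 = 0 /\ xi2 ^+ 2 = 0.
  by split; nra.
split; first by apply/eqP; rewrite -sqrf_eq0 u20.
by split; apply/eqP; rewrite -sqrf_eq0 ?xi12 xi20.
Qed.

Definition quad_poly (R : nzRingType) (a0 a1 a2 : R) : {poly R} :=
  a0%:P + a1 *: 'X + a2 *: 'X^2.

Lemma horner_quad_poly (R : comNzRingType) (a0 a1 a2 s : R) :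
  (quad_poly a0 a1 a2).[s] = a0 + a1 * s + a2 * s ^+ 2.
Proof. by rewrite /quad_poly !(hornerE, horner_exp). Qed.

(* If the support functions of [W] and of the ellipse [o, k, m, l] agree on an
   open set of directions then squaring twice leaves a relation
   [al + de * Num.sqrt Q = 0] between polynomials, so that [al] and [de] vanish
   because [Q] is not a square. *)
Lemma support_agree_identities (R : realType) (u b : R) (b1 b2 : R[i])
    (k m l : R) (o : R[i]) (c s0 tau : R) :
  0 < k -> 0 < l -> m ^+ 2 < k * l -> c != 0 -> o != 0 -> 0 < tau ->
  (forall s, s0 <= s -> s < s0 + tau ->
     nr_support u b b1 b2 c s =
     c * Re o + s * Im o + Num.sqrt (dual_form k m l c s)) ->
  (forall s, (c * Re o + s * Im o) ^+ 2 + dual_form k m l c s =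
     c ^+ 2 * u ^+ 2
     + (sqabs (pencil b1 c s) + sqabs (pencil b2 c s) + c ^+ 2 * b ^+ 2) / 2) /\
  (forall s, 16 * (c * Re o + s * Im o) ^+ 2 * dual_form k m l c s =
     c ^+ 2 * disc b b1 b2 c s).
Proof.
move=> k0 l0 kml c0 o0 tau0 H.
pose N := sqabs b1 + sqabs b2; pose E := Im b1 + Im b2.
pose De := sqabs b1 - sqabs b2; pose dl := Im b1 - Im b2.
pose L := quad_poly (c * Re o) (Im o) 0.
pose Q := quad_poly (k * c ^+ 2) (2 * m * c) l.
pose M := quad_poly (c ^+ 2 * u ^+ 2 + (c ^+ 2 * N + c ^+ 2 * b ^+ 2) / 2) (c * E) 1.
pose D := quad_poly ((c * De) ^+ 2 + 2 * b ^+ 2 * (c ^+ 2 * N) + c ^+ 2 * b ^+ 4)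
  (4 * (c * De) * dl + 4 * b ^+ 2 * c * E) (4 * dl ^+ 2 + 4 * b ^+ 2).
have LE s : L.[s] = c * Re o + s * Im o by rewrite horner_quad_poly; ring.
have QE s : Q.[s] = dual_form k m l c s.
  by rewrite horner_quad_poly /dual_form; ring.
have ME s : M.[s] = c ^+ 2 * u ^+ 2
     + (sqabs (pencil b1 c s) + sqabs (pencil b2 c s) + c ^+ 2 * b ^+ 2) / 2.
  by rewrite horner_quad_poly /N /E /sqabs /=; field.
have DE s : D.[s] = disc b b1 b2 c s.
  by rewrite horner_quad_poly /disc /N /E /De /dl /sqabs /=; ring.
(* [al] and [de] collect the parts without and with the root of [Q] in
   [((L + sqrt Q)^2 - M)^2 - c^2 D / 4]. *)
clearbody L Q M D; pose al := (L ^+ 2 + Q - M) ^+ 2 + 4 *: (L ^+ 2 * Q) - (c ^+ 2 / 4) *: D.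
pose de := 4 *: (L * (L ^+ 2 + Q - M)).
have [] := @dual_sqrt_indep R k m l c al de s0 tau => //.
  move=> s s1 s2; have {H} := H s s1 s2; rewrite -LE -QE.
  have := nr_support_sqr u b b1 b2 c s; set h := nr_support _ _ _ _ _ _.
  have -> : c ^+ 2 * u ^+ 2 + sval2 b b1 b2 c s = M.[s] + `|c| * Num.sqrt D.[s] / 2.
    by rewrite ME DE /sval2; field.
  have rD : (`|c| * Num.sqrt D.[s]) ^+ 2 = c ^+ 2 * D.[s].
    by rewrite exprMn real_normK ?num_real // DE sqr_sqrtr ?disc_ge0.
  have rQ : Num.sqrt Q.[s] ^+ 2 = Q.[s] by rewrite QE sqr_sqrtr ?dual_form_ge0.
  have -> : al.[s] + de.[s] * Num.sqrt Q.[s] =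
     (L.[s] ^+ 2 + Q.[s] - M.[s]) ^+ 2 + 4 * L.[s] ^+ 2 * Q.[s] - c ^+ 2 * D.[s] / 4
     + 4 * L.[s] * (L.[s] ^+ 2 + Q.[s] - M.[s]) * Num.sqrt Q.[s].
    by rewrite /al /de !(hornerD, hornerN, hornerZ, horner_exp, hornerM); field.
  rewrite -rD; set r := `|c| * Num.sqrt D.[s]; set q := Num.sqrt Q.[s] in rQ *.
  rewrite -rQ => h2 hE.
  have : (h ^+ 2 - M.[s]) ^+ 2 = r ^+ 2 / 4 by rewrite h2; field.
  rewrite hE => e; transitivity (((L.[s] + q) ^+ 2 - M.[s]) ^+ 2 - r ^+ 2 / 4).
    by field.
  by rewrite e subrr.
move=> al0 de0.
have Lneq0 : L != 0.
  apply: contra o0 => /eqP L0; have := LE 0; have := LE 1.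
  rewrite L0 !horner0 mul0r mul1r addr0 => e1 /esym/eqP.
  rewrite mulf_eq0 (negPf c0) /= => /eqP e2; move: e1; rewrite e2 mulr0 add0r => e1.
  by rewrite eq_complex e2 -e1 /= !eqxx.
(* The center is not 0, so [L] cancels from [de = 0]. This is the first identity, and it reduces
   [al = 0] to the second. *)
have LQM : L ^+ 2 + Q - M = 0.
  move: de0; rewrite /de -mul_polyC => /eqP; rewrite !mulf_eq0 polyC_eq0 pnatr_eq0 /=.
  by rewrite (negPf Lneq0) => /eqP.
split=> s.
  rewrite -LE -QE -ME; apply/eqP; rewrite -subr_eq0.
  by rewrite -horner_exp -!(hornerD, hornerN) LQM horner0.
have := congr1 (horner^~ s) al0.
rewrite /al LQM expr0n add0r !(hornerD, hornerN, hornerZ, horner_exp, hornerM) horner0 LE QE DE.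
by lra.
Qed.

(** A point [z] of the first ellipse outside the second disk is separated from it in some direction.
    Nearby directions still separate, and there the support function of the numerical range is that
    of the first ellipse, whose center is not 0. *)
Lemma bi_elliptical_necessary (R : realType) (u b : R) (b1 b2 o1 o2 : R[i])
    (k1 m1 l1 k2 m2 l2 : R) :
  0 < k1 -> 0 < l1 -> m1 ^+ 2 < k1 * l1 ->
  0 < k2 -> 0 < l2 -> m2 ^+ 2 < k2 * l2 -> o1 != 0 ->
  ~ (forall z, dual_ellipse o1 k1 m1 l1 z -> convex_hull (dual_ellipse o2 k2 m2 l2) z) ->
  (forall z, numerical_range (block_matrix u b b1 b2) z <->
     convex_hull (fun z => dual_ellipse o1 k1 m1 l1 z \/ dual_ellipse o2 k2 m2 l2 z) z) ->
  b <> 0 /\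
  ((Im b1 = Im b2 /\ 4 * b ^+ 2 * u ^+ 2 = (Re b1 ^+ 2 - Re b2 ^+ 2) ^+ 2) \/
   (u = 0 /\ Re b1 = 0 /\ Re b2 = 0)).
Proof.
move=> k10 l10 kml1 k20 l20 kml2 o10 sub WE.
pose h1 c s := c * Re o1 + s * Im o1 + Num.sqrt (dual_form k1 m1 l1 c s).
pose h2 c s := c * Re o2 + s * Im o2 + Num.sqrt (dual_form k2 m2 l2 c s).
have E1le z c s : dual_ellipse o1 k1 m1 l1 z -> c * Re z + s * Im z <= h1 c s.
  by move=> Ez; apply: dual_hull_support => //; apply: sub_convex_hull.
have E2le z c s : dual_ellipse o2 k2 m2 l2 z -> c * Re z + s * Im z <= h2 c s.
  by move=> Ez; apply: dual_hull_support => //; apply: sub_convex_hull.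
have agree c s : h2 c s < h1 c s -> nr_support u b b1 b2 c s = h1 c s.
  move=> h21; apply/le_anti/andP; split.
    have [z zW <-] := numerical_range_support_attained u b b1 b2 c s.
    move/WE: zW; apply: convex_hull_halfplane => {}z [/E1le//|/E2le h].
    exact: le_trans (h c s) (ltW h21).
  have [z zE e] := dual_support_attained k10 kml1 o1 c s.
  rewrite /h1 -e; apply: numerical_range_support_le.
  by apply/WE; apply: sub_convex_hull; left.
have [z zE1 zE2] : exists2 z, dual_ellipse o1 k1 m1 l1 z &
    ~ convex_hull (dual_ellipse o2 k2 m2 l2) z.
  apply: contrapT => none; apply: sub => z zE1; apply: contrapT => zE2.
  by apply: none; exists z.
pose g c s := c * Re z + s * Im z - h2 c s.
have gh c s : 0 < g c s -> h2 c s < h1 c s.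
  by rewrite subr_gt0 => h; apply: lt_le_trans h (E1le _ _ _ zE1).
(* [g] is superadditive because [h2] is subadditive, so its positivity persists under small changes
   of direction. *)
have gD c s c' s' t : 0 <= t -> g c s + t * g c' s' <= g (c + t * c') (s + t * s').
  move=> t0; rewrite /g.
  have [v vE e] := dual_support_attained k20 kml2 o2 (c + t * c') (s + t * s').
  rewrite [h2 (c + t * c') _]/h2 -e; have e1 := E2le v c s vE.
  by have := ler_wpM2l t0 (E2le v c' s' vE); lra.
have gopen c s c' s' : 0 < g c s ->
    exists2 tau, 0 < tau & forall t, 0 <= t -> t < tau -> 0 < g (c + t * c') (s + t * s').
  move=> g0; have d0 : 0 < 1 + `|g c' s'| by rewrite ltr_pwDl.
  exists (g c s / (1 + `|g c' s'|)); first by rewrite divr_gt0.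
  move=> t t0; rewrite ltr_pdivlMr // => tg.
  apply: lt_le_trans (gD _ _ _ _ _ t0).
  have : t * - `|g c' s'| <= t * g c' s' by rewrite ler_wpM2l // lerNl -normrN ler_norm.
  lra.
have [c [s [c0 g0]]] : exists c s, c != 0 /\ 0 < g c s.
  have [c [s]] : exists c s, 0 < g c s.
    have [|c [s cs]] := @dual_separation _ k2 m2 l2 kml2 (Re z - Re o2) (Im z - Im o2).
      by rewrite ltNge; apply/negP => /(dual_disk_convex_hull l20)/zE2.
    by exists c, s; rewrite /g /h2; move: cs; lra.
  have [->|c0] := eqVneq c 0 => g0; last by exists c, s.
  (* A vertical direction is tilted slightly to make [c] nonzero. *)
  have [tau tau0 /(_ (tau / 2))] := gopen 0 s 1 0 g0.
  move=> H; exists (0 + tau / 2 * 1), (s + tau / 2 * 0); split; last by apply: H; lra.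
  by rewrite add0r mulr1 mulf_neq0 ?invr_eq0 ?pnatr_eq0 // gt_eqF.
have [tau tau0 gtau] := gopen c s 0 1 g0.
have agr t : s <= t -> t < s + tau -> nr_support u b b1 b2 c t = h1 c t.
  move=> t1 t2; apply: agree; apply: gh.
  by have := gtau (t - s); rewrite mulr0 addr0 mulr1 [s + _]addrC subrK; apply; lra.
have [id1 id2] := support_agree_identities k10 l10 kml1 c0 o10 tau0 agr.
apply: (@support_identities_coef R u b b1 b2 k1 m1 l1 (Re o1) (Im o1) c) => //.
by apply: contraNT o10; rewrite negb_or !negbK => /andP[e1 e2]; rewrite eq_complex /= e1.
Qed.

(** * Sufficiency *)

Section Stadium.
Variables (R : realType) (k m x0 : R).
Hypotheses (km : m ^+ 2 < k) (x0_gt0 : 0 < x0).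

Let D := k - m ^+ 2.
Let D0 : 0 < D. Proof. by rewrite subr_gt0. Qed.
Let k0 : 0 < k. Proof. exact: le_lt_trans (sqr_ge0 _) km. Qed.
Let km1 : m ^+ 2 < k * 1. Proof. by rewrite mulr1. Qed.

Let halfwidth (y : R) := Num.sqrt (D * (1 - y ^+ 2)).

Let halfwidth_sqr y : y ^+ 2 <= 1 -> halfwidth y ^+ 2 = D * (1 - y ^+ 2).
Proof. by move=> y1; rewrite sqr_sqrtr // mulr_ge0 ?(ltW D0) // subr_ge0. Qed.

Let sqr1P (e : R) : e ^+ 2 = 1 -> e = 1 \/ e = -1.
Proof. by move/eqP; rewrite sqrf_eq1 => /orP[/eqP|/eqP]; [left|right]. Qed.

(** The directions [(0, 1)] and [(0, -1)] bound [y]; the normal of the ellipse at the end of the row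
    at height [y] bounds [x]. *)
Lemma stadium_row (x y e : R) :
  (forall c s, c * x + s * y <= `|c| * x0 + Num.sqrt (dual_form k m 1 c s)) ->
  e ^+ 2 = 1 -> y ^+ 2 <= 1 /\ e * x <= e * (m * y) + halfwidth y + x0.
Proof.
move=> H e1.
have y1 : y ^+ 2 <= 1.
  have := H 0 1; have := H 0 (-1).
  rewrite /dual_form !expr0n sqrrN !expr1n normr0 !(mulr0, mul0r, add0r, mulr1) sqrtr1.
  nra.
split=> //; have h2 := halfwidth_sqr y1; set h := halfwidth y in h2 *.
have ne : `|e| = 1.
  by have [->|->] := sqr1P e1; rewrite ?normrN normr1.
(* At the top and bottom that normal is vertical and says nothing about [x]. A direction with small
   horizontal part [e * t] is used instead, with [sqrt v <= (1 + v) / 2]. *)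
have [h0|h0] := eqVneq h 0.
  rewrite h0 addr0 leNgt; apply/negP => gap.
  have y2 : y ^+ 2 = 1.
    move: h2; rewrite h0 expr0n => /esym/eqP; rewrite mulf_eq0 (gt_eqF D0) subr_eq0.
    by move=> /eqP.
  pose d := e * x - e * (m * y) - x0.
  have d0 : 0 < d by rewrite /d; lra.
  pose t := d / k; have t0 : 0 < t by rewrite divr_gt0.
  have := H (e * t) y; rewrite normrM ne mul1r (gtr0_norm t0).
  set v := dual_form _ _ _ _ _.
  have vE : v = 1 + t * (2 * e * m * y + d).
    by rewrite /v /dual_form y2 exprMn e1 /t; field; rewrite gt_eqF.
  have v0 : 0 <= v by apply: dual_form_ge0.
  have sv : Num.sqrt v <= (1 + v) / 2.
    by have := sqr_ge0 (Num.sqrt v - 1); rewrite sqrrB sqr_sqrtr // expr1n; lra.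
  have : 0 < t * d by rewrite mulr_gt0.
  move: sv; rewrite vE -expr2 y2 /d; lra.
have hgt : 0 < h by rewrite lt_neqAle eq_sym h0 sqrtr_ge0.
(* The normal at the point [(m * y + e * h, y)] of the centered ellipse. *)
have := H (e * h) (D * y - e * m * h).
have -> : dual_form k m 1 (e * h) (D * y - e * m * h) = D ^+ 2.
  transitivity (D * (e ^+ 2 * h ^+ 2) + D ^+ 2 * y ^+ 2).
    by rewrite /dual_form /D; ring.
  by rewrite e1 h2; ring.
rewrite sqrtr_sqr (gtr0_norm D0) normrM ne mul1r (gtr0_norm hgt) => le.
rewrite -(ler_pM2l hgt) !mulrDr -expr2 h2; lra.
Qed.

Lemma stadium_row_mem (y e : R) : y ^+ 2 <= 1 -> e ^+ 2 = 1 ->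
  1 * (m * y + e * halfwidth y) ^+ 2 - 2 * m * (m * y + e * halfwidth y) * y
  + k * y ^+ 2 = k * 1 - m ^+ 2.
Proof.
move=> y1 e1; transitivity (e ^+ 2 * halfwidth y ^+ 2 + D * y ^+ 2).
  by rewrite /D; ring.
by rewrite e1 halfwidth_sqr // /D; ring.
Qed.

Variable W : set R[i].
Hypothesis W_convex : @convex_set R (Rcomplex R) W.
Hypothesis W_le : forall z c s, W z ->
  c * Re z + s * Im z <= `|c| * x0 + Num.sqrt (dual_form k m 1 c s).
Hypothesis W_attained : forall c s, c != 0 -> exists2 z, W z &
  c * Re z + s * Im z = `|c| * x0 + Num.sqrt (dual_form k m 1 c s).
(** The ends of the two flat sides. For [c = 0] the maximizers fill a whole segment, so attainment
    would not locate them. *)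
Hypothesis W_flat : forall e f, e ^+ 2 = 1 -> f ^+ 2 = 1 ->
  W ((m * f + e * x0) +i* f).

(** [W] attains its support function in the normal direction at [(X, Y)]. By [stadium_row] the
    attaining point lies no further out than the end of its row; equality must hold, and uniqueness
    of the maximizer on the ellipse identifies the point. *)
Lemma stadium_outer (X Y e : R) : e ^+ 2 = 1 ->
  1 * X ^+ 2 - 2 * m * X * Y + k * Y ^+ 2 = k * 1 - m ^+ 2 ->
  0 <= e * (X - m * Y) -> W ((X + e * x0) +i* Y).
Proof.
move=> e1 XY; set c := X - m * Y; set s := k * Y - m * X => ec.
have [c0|c0] := eqVneq c 0.
  have XE : X = m * Y by apply/eqP; rewrite -subr_eq0 -/c c0.
  rewrite XE; apply: W_flat => //; apply: (mulfI (lt0r_neq0 D0)).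
  by move: XY; rewrite XE /D; lra.
have ce : `|c| = e * c.
  by rewrite -[RHS]ger0_norm // normrM; have [->|->] := sqr1P e1; rewrite ?normrN normr1 mul1r.
have formE : dual_form k m 1 c s = D ^+ 2.
  transitivity (D * (1 * X ^+ 2 - 2 * m * X * Y + k * Y ^+ 2)).
    by rewrite /dual_form /c /s /D; ring.
  by rewrite XY /D; ring.
have sqrtE : Num.sqrt (dual_form k m 1 c s) = D.
  by rewrite formE sqrtr_sqr gtr0_norm.
have [[x y] zW] := W_attained s c0; rewrite sqrtE /= => zE.
have [/= y1 xle] := stadium_row (fun c s => W_le c s zW) e1.
have := stadium_row_mem y1 e1; set X' := m * y + e * halfwidth y => X'E.
have X'le : 1 * X' ^+ 2 - 2 * m * X' * y + k * y ^+ 2 <= k * 1 - m ^+ 2 by rewrite X'E.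
have c0' : 0 < `|c| by rewrite normr_gt0.
have xX' : c * x <= c * X' + `|c| * x0.
  have -> : c = `|c| * e by rewrite ce mulrAC -expr2 e1 mul1r.
  have := ler_wpM2l (ltW c0') xle.
  have -> : `|c| * (e * (m * y) + halfwidth y + x0) = `|c| * e * X' + `|c| * x0.
    transitivity (`|c| * (e * (m * y) + 1 * halfwidth y + x0)); first by ring.
    by rewrite -e1 /X'; ring.
  by rewrite mulrA normrM normr_id; have [->|->] := sqr1P e1; rewrite ?normrN normr1 mulr1.
have := dual_support_le k0 km1 c s X'le; rewrite sqrtE => le.
have X'eq : c * X' + s * y = D by lra.
have cs : (c != 0) || (s != 0) by rewrite c0.
have := dual_support_unique k0 km1 cs X'le; rewrite sqrtE => /(_ X'eq)[XD YD].
have DX : X' = X.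
  by apply: (mulIf (lt0r_neq0 D0)); rewrite XD /c /s /D; ring.
have DY : y = Y.
  by apply: (mulIf (lt0r_neq0 D0)); rewrite YD /c /s /D; ring.
move: zW; congr (W (_ +i* _)) => //; apply: (mulfI c0).
rewrite mulrDr mulrA -[c * e]mulrC -ce -DX; lra.
Qed.

(** A point of the inner half lies, on its row, between an outer point of the other translate and
    its own mirror image [2 * m * Y - X], which is an outer point of the same translate. *)
Lemma stadium_ellipse_sub (e : R) z : e ^+ 2 = 1 ->
  dual_ellipse (e * x0)%:C k m 1 z -> W z.
Proof.
case: z => [x Y] e1; rewrite /dual_ellipse /= subr0.
have -> : x = (x - e * x0) + e * x0 by rewrite subrK.
set X := x - e * x0; rewrite addrK => XY.
have [h|h] := leP 0 (e * (X - m * Y)); first exact: stadium_outer.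
have XY' : 1 * (2 * m * Y - X) ^+ 2 - 2 * m * (2 * m * Y - X) * Y + k * Y ^+ 2
   = k * 1 - m ^+ 2 by rewrite -XY; ring.
have W1 := stadium_outer e1 XY'.
have Ne1 : (- e) ^+ 2 = 1 by rewrite sqrrN.
have W2 := stadium_outer Ne1 XY.
have {}W1 : W ((2 * m * Y - X + e * x0) +i* Y) by apply: W1; lra.
have {}W2 : W ((X + - e * x0) +i* Y) by apply: W2; lra.
have [ee|ee] := sqr1P e1.
  by apply: (convex_set_hsegment W_convex W2 W1); move: h x0_gt0; rewrite ee; lra.
by apply: (convex_set_hsegment W_convex W1 W2); move: h x0_gt0; rewrite ee; lra.
Qed.

(** For the inclusion of [W] in the hull, the bounds of [stadium_row] on each row are points of the
    two ellipses. *)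
Lemma stadium_hull z : W z <->
  convex_hull (fun z => dual_ellipse x0%:C k m 1 z \/ dual_ellipse (- x0)%:C k m 1 z) z.
Proof.
split=> [|]; last first.
  apply: convex_hull_min => // {}z [zE|zE].
    by apply: (@stadium_ellipse_sub 1); rewrite ?expr1n ?mul1r.
  by apply: (@stadium_ellipse_sub (-1)); rewrite ?sqrrN ?expr1n ?mulN1r.
case: z => [x y] zW.
have one1 : 1 ^+ 2 = 1 :> R by rewrite expr1n.
have mone1 : (-1) ^+ 2 = 1 :> R by rewrite sqrrN expr1n.
have [/= y1 xle] := stadium_row (fun c s => W_le c s zW) one1.
have [/= _ xge] := stadium_row (fun c s => W_le c s zW) mone1.
apply: (@convex_set_hsegment _ _ (m * y + -1 * halfwidth y - x0)
  (m * y + 1 * halfwidth y + x0)); [exact: convex_hull_convex| | |lra|lra].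
  apply: sub_convex_hull; right; rewrite /dual_ellipse /= subr0 opprK subrK.
  exact: stadium_row_mem.
apply: sub_convex_hull; left; rewrite /dual_ellipse /= subr0 addrK.
exact: stadium_row_mem.
Qed.

End Stadium.

(** * The two ellipses under condition (i) or (ii) *)

Section Sufficiency.
Variables (R : realType) (u b : R) (b1 b2 : R[i]).
Hypothesis b0 : b != 0.
Hypothesis cond :
  (Im b1 = Im b2 /\ 4 * b ^+ 2 * u ^+ 2 = (Re b1 ^+ 2 - Re b2 ^+ 2) ^+ 2) \/
  (u = 0 /\ Re b1 = 0 /\ Re b2 = 0).

(** These are the values found by comparing coefficients in [support_identities_coef], where also
    [l = 1]. *)
Let x0 := Num.sqrt ((Im b1 - Im b2) ^+ 2 + b ^+ 2) / 2.
Let m := (Im b1 + Im b2) / 2.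
Let k := u ^+ 2 + (sqabs b1 + sqabs b2 + b ^+ 2) / 2 - x0 ^+ 2.

Let x0_sqr : x0 ^+ 2 = ((Im b1 - Im b2) ^+ 2 + b ^+ 2) / 4.
Proof.
rewrite /x0 expr_div_n sqr_sqrtr ?addr_ge0 ?sqr_ge0 //; congr (_ / _).
by ring.
Qed.

Lemma center_gt0 : 0 < x0.
Proof.
rewrite divr_gt0 // sqrtr_gt0 ltr_wpDl ?sqr_ge0 //.
by rewrite exprn_even_gt0.
Qed.

Lemma disc_dual_form c s : disc b b1 b2 c s = 16 * x0 ^+ 2 * dual_form k m 1 c s.
Proof.
rewrite /k x0_sqr /m /disc /dual_form /sqabs /=.
move: cond; case: b1 b2 => [xi1 eta1] [xi2 eta2] /= [[-> h]|[-> [-> ->]]]; last by field.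
(* In case (i), [16 * x0 ^+ 2 * k] contains [4 * b ^+ 2 * u ^+ 2], which the hypothesis turns into
   the required square. *)
set r := (RHS); have -> : r = (c * (xi1 ^+ 2 - xi2 ^+ 2)) ^+ 2
  + 2 * b ^+ 2 * ((c * xi1) ^+ 2 + (c * eta2 + s) ^+ 2
     + ((c * xi2) ^+ 2 + (c * eta2 + s) ^+ 2)) + c ^+ 2 * b ^+ 4.
  by rewrite exprMn -h /r; field.
by ring.
Qed.

(** [k - m ^+ 2] is the value of the form at [(1, - m)], a positive multiple of [disc], which is at
    least [b ^+ 4] there. *)
Lemma dual_form_pd : m ^+ 2 < k.
Proof.
have x2 : 0 < 16 * x0 ^+ 2 by rewrite mulr_gt0 // exprn_gt0 // center_gt0.
rewrite -subr_gt0 -(pmulr_rgt0 _ x2).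
have -> : k - m ^+ 2 = dual_form k m 1 1 (- m) by rewrite /dual_form; ring.
rewrite -disc_dual_form /disc; apply: ltr_wpDl.
  apply: addr_ge0; first exact: sqr_ge0.
  apply: mulr_ge0; first by rewrite mulr_ge0 ?sqr_ge0.
  exact: addr_ge0 (sqabs_ge0 _) (sqabs_ge0 _).
by rewrite expr1n mul1r exprn_even_gt0.
Qed.

Lemma nr_support_stadium c s :
  nr_support u b b1 b2 c s = `|c| * x0 + Num.sqrt (dual_form k m 1 c s).
Proof.
have k0 : 0 < k := le_lt_trans (sqr_ge0 _) dual_form_pd.
have f0 : 0 <= dual_form k m 1 c s.
  by apply: dual_form_ge0 => //; rewrite mulr1 dual_form_pd.
have h0 : 0 <= `|c| * x0 + Num.sqrt (dual_form k m 1 c s).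
  by rewrite addr_ge0 ?sqrtr_ge0 // mulr_ge0 // ltW ?center_gt0.
rewrite -[RHS]ger0_norm // -sqrtr_sqr /nr_support; congr Num.sqrt.
rewrite sqrrD sqr_sqrtr // exprMn real_normK ?num_real // /sval2 disc_dual_form.
have -> : Num.sqrt (16 * x0 ^+ 2 * dual_form k m 1 c s) =
    4 * x0 * Num.sqrt (dual_form k m 1 c s).
  rewrite sqrtrM ?mulr_ge0 ?sqr_ge0 //; congr (_ * _).
  have -> : 16 * x0 ^+ 2 = (4 * x0) ^+ 2 by ring.
  by rewrite sqrtr_sqr ger0_norm // mulr_ge0 // ltW ?center_gt0.
by rewrite /dual_form /k /m x0_sqr /sqabs /=; field.
Qed.

(** An extreme imaginary part [f] is reached by vectors [(x, f i x)]. On these the real part is [f]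
    times the Hermitian form of the imaginary part of [B], whose eigenvalues [mu] satisfy [muE];
    [(p, i t)] is an eigenvector for [mu]. *)
Lemma numerical_range_flat e f : e ^+ 2 = 1 -> f ^+ 2 = 1 ->
  numerical_range (block_matrix u b b1 b2) ((m * f + e * x0) +i* f).
Proof.
move=> e1 f1; pose mu := m + e * f * x0.
have muE : (mu - Im b1) * (mu - Im b2) = b ^+ 2 / 4.
  transitivity ((e ^+ 2 * f ^+ 2) * x0 ^+ 2 - (Im b1 - Im b2) ^+ 2 / 4).
    by rewrite /mu /m; field.
  by rewrite e1 f1 x0_sqr; field.
pose p := b / 2; pose t := mu - Im b1.
apply/numerical_range_blockP; exists (p +i* 0, 0 +i* t), (0 +i* (f * p), (- (f * t)) +i* 0).
have nE : sqnorm (p +i* 0, 0 +i* t) + sqnorm (0 +i* (f * p), (- (f * t)) +i* 0)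
    = 2 * (p ^+ 2 + t ^+ 2).
  transitivity ((1 + f ^+ 2) * (p ^+ 2 + t ^+ 2)); first by rewrite /sqnorm /sqabs /=; ring.
  by rewrite f1.
rewrite nE; split.
- rewrite mulf_neq0 ?pnatr_eq0 // gt_eqF // ltr_pwDl ?sqr_ge0 //.
  by rewrite exprn_even_gt0 //= mulf_neq0 ?invr_eq0 ?pnatr_eq0.
- have tE : t * (mu - Im b2) = p ^+ 2 by rewrite muE /p; field.
  transitivity (u * ((1 - f ^+ 2) * (p ^+ 2 + t ^+ 2))
     + 2 * f * (Im b1 * p ^+ 2 + Im b2 * t ^+ 2 + 2 * p ^+ 2 * t)).
    by rewrite /re_form /redot /sqnorm /sqabs /p; case: b1 b2 => [? ?] [? ?] /=; field.
  have -> : Re ((m * f + e * x0) +i* f) = f * mu.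
    transitivity (m * f + f ^+ 2 * (e * x0)); first by rewrite f1 mul1r.
    by rewrite /mu; ring.
  have -> : Im b1 * p ^+ 2 + Im b2 * t ^+ 2 + 2 * p ^+ 2 * t = mu * (p ^+ 2 + t ^+ 2).
    apply/eqP; rewrite -subr_eq0; apply/eqP.
    transitivity (t * (p ^+ 2 - t * (mu - Im b2)) + p ^+ 2 * (t - (mu - Im b1))).
      by ring.
    by rewrite tE /t !subrr !mulr0 addr0.
  by rewrite f1; ring.
- rewrite /im_form /redot /=; ring.
Qed.

Lemma bi_elliptical_sufficient :
  bi_elliptical (numerical_range (block_matrix u b b1 b2)).
Proof.
have x00 := center_gt0; have kmP := dual_form_pd.
have k0 : 0 < k := le_lt_trans (sqr_ge0 _) kmP.
have kmP1 : m ^+ 2 < k * 1 by rewrite mulr1.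
(* In the horizontal direction [e] the support functions of the two translates differ by
   [(e - f) * e * x0]. *)
have notsub (e f : R) : 0 < (e - f) * e -> e ^+ 2 = 1 -> 
    ~ (dual_ellipse (e * x0)%:C k m 1 `<=` convex_hull (dual_ellipse (f * x0)%:C k m 1))%classic.
  move=> ef e1 sub.
  have [z zE ez] := dual_support_attained k0 kmP1 (e * x0)%:C e 0.
  have := dual_hull_support k0 kmP1 e 0 (sub z zE); rewrite {}ez /= lerD2r !mul0r !addr0.
  have : 0 < (e - f) * e * x0 by rewrite mulr_gt0.
  lra.
exists x0%:C, (- x0)%:C, (dual_ellipse x0%:C k m 1), (dual_ellipse (- x0)%:C k m 1).
split.
- by split; apply/is_ellipseP; exists k, m, 1.
- by move=> [e]; move: x00; lra.
- by have := notsub 1 (-1); rewrite !mul1r !mulN1r expr1n; apply=> //; lra.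
- by have := notsub (-1) 1; rewrite !mul1r !mulN1r sqrrN expr1n; apply=> //; lra.
apply/seteqP; rewrite /block_matrix.
have hull z : numerical_range (block_matrix u b b1 b2) z <->
    convex_hull (dual_ellipse x0%:C k m 1 `|` dual_ellipse (- x0)%:C k m 1)%classic z.
  apply: stadium_hull => //.
  - exact: numerical_range_convex.
  - by move=> {}z c s zW; rewrite -nr_support_stadium; apply: numerical_range_support_le.
  - move=> c s _; rewrite -nr_support_stadium.
    exact: numerical_range_support_attained.
  - exact: numerical_range_flat.
by split=> z /hull.
Qed.

End Sufficiency.

Theorem theorem3 (R : realType) (u b : R) (b1 b2 : R[i]) (hb : 0 <= b) :
  let A : 'M[R[i]]_4 := mx_of_rows 4 4
    [:: [:: u%:C      ; 0          ; b1^* + 1   ; 0         ];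
        [:: 0         ; u%:C       ; b%:C       ; b2^* + 1  ];
        [:: b1 - 1    ; b%:C       ; - u%:C     ; 0         ];
        [:: 0         ; b2 - 1     ; 0          ; - u%:C    ]] in
  let xi1 := complex.Re b1 in
  let xi2 := complex.Re b2 in
  let eta1 := complex.Im b1 in
  let eta2 := complex.Im b2 in
  bi_elliptical (numerical_range A) <->
  b <> 0 /\
  ((eta1 = eta2 /\ 4 * b ^+ 2 * u ^+ 2 = (xi1 ^+ 2 - xi2 ^+ 2) ^+ 2) \/
   (u = 0 /\ xi1 = 0 /\ xi2 = 0)).
Proof.
move=> A xi1 xi2 eta1 eta2; rewrite -[A]/(block_matrix u b b1 b2).
split=> [|[/eqP b0 cond]]; last exact: bi_elliptical_sufficient.
move=> [o1 [o2 [E1 [E2 [[/is_ellipseP ell1 /is_ellipseP ell2] o12 sub1 sub2 WE]]]]].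
case: ell1 => k1 [m1 [l1 [k10 l10 kml1 E1E]]].
case: ell2 => k2 [m2 [l2 [k20 l20 kml2 E2E]]].
rewrite {}E1E {}E2E in sub1 sub2 WE.
(* The centers are distinct, so one of them is not 0; the argument is symmetric in the two
   ellipses. *)
have [o10|o10] := eqVneq o1 0; last first.
  by apply: (bi_elliptical_necessary k10 l10 kml1 k20 l20 kml2 o10 sub1) => z; rewrite WE.
have o20 : o2 != 0 by apply/eqP => o20; apply: o12; rewrite o10 o20.
apply: (bi_elliptical_necessary k20 l20 kml2 k10 l10 kml1 o20 sub2) => z.
by rewrite WE setUC.
Qed.
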